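(* Let $R$ be a ring. The PGF dimension of a Gorenstein projective $R$-module $M$ is either zero or infinite. Consequently, the global dimension $$\mathrm{PGFD}_{\mathcal{GP}(R)}(R)=\sup\{\mathrm{PGF\text{-}pd}_R(M)\mid M\in\mathcal{GP}(R)\}$$ is either zero or infinite.
   Context: $R$ is an associative ring with identity; ''$R$-module'' means unital left $R$-module. An $R$-module is PGF (projectively coresolved Gorenstein flat) if it is a syzygy (kernel of a differential) of an exact (doubly infinite) complex of projective $R$-modules that stays exact after applying $E\otimes_R-$ for every injective right $R$-module $E$. An $R$-module is Gorenstein projective if it is a syzygy of an exact complex of projective $R$-modules that stays exact after applying $\mathrm{Hom}_R(-,P)$ for every projective $R$-module $P$; $\mathcal{GP}(R)$ is the class of these. The PGF dimension $\mathrm{PGF\text{-}pd}_R(M)$ is the least $k\ge0$ such that there is an exact sequence $0\to G_k\to\cdots\to G_0\to M\to0$ with all $G_i$ PGF, and $\infty$ if no such $k$ exists. *)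

(* Defs.v *)
From HB Require Import structures.
From mathcomp Require Import all_boot all_order all_algebra.
From mathcomp Require Import boolp classical_sets.
From mathcomp Require Import freeg.

Set Implicit Arguments.
Unset Strict Implicit.
Unset Printing Implicit Defensive.

Import GRing.Theory.
Local Open Scope ring_scope.

(* Rings are [pzRingType]s, so that the zero ring is allowed.  Left R-modules *)
(* are [lmodType R]; right R-modules are left modules over the converse ring, *)
(* [lmodType R^c], where [r *: e] for [r : R^c] stands for e r.               *)

Definition is_surjective (A B : Type) (f : A -> B) := forall y, exists x, f x = y.

(* Exactness of A --f--> B --g--> C at B. *)
Definition exact_pair (A : Type) (B : Type) (C : zmodType)
    (f : A -> B) (g : B -> C) :=
  forall y, g y = 0 <-> exists x, f x = y.

Definition projective_module (S : pzRingType) (P : lmodType S) :=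
  forall (A B : lmodType S) (g : {linear A -> B}) (f : {linear P -> B}),
    is_surjective g -> exists h : {linear P -> A}, forall x, g (h x) = f x.

Definition injective_module (S : pzRingType) (E : lmodType S) :=
  forall (A B : lmodType S) (i : {linear A -> B}) (f : {linear A -> E}),
    injective i -> exists h : {linear B -> E}, forall x, h (i x) = f x.

(* The tensor product E (x)_R M: the free abelian group on E * M modulo the   *)
(* subgroup generated by the bilinearity and balancing relations.             *)
Section Tensor.
Context (R : pzRingType) (E : lmodType R^c) (M : lmodType R).

Definition tensor_free : zmodType := {freeg (E * M)%type / int}.

Definition tensor_gen (e : E) (m : M) : tensor_free := << (e, m) >>.

Inductive tensor_relation : tensor_free -> Prop :=
| tensor_relation0 : tensor_relation 0
| tensor_relationB u v :
    tensor_relation u -> tensor_relation v -> tensor_relation (u - v)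
| tensor_relationDl e e' m :
    tensor_relation (tensor_gen (e + e') m - (tensor_gen e m + tensor_gen e' m))
| tensor_relationDr e m m' :
    tensor_relation (tensor_gen e (m + m') - (tensor_gen e m + tensor_gen e m'))
| tensor_relationZ e (r : R) m :
    tensor_relation (tensor_gen ((r : R^c) *: e) m - tensor_gen e (r *: m)).

Definition tensor_relations : {pred tensor_free} :=
  fun u => `[< tensor_relation u >].

Lemma tensor_relations_closed : zmod_closed tensor_relations.
Proof.
split=> [|u v /asboolP hu /asboolP hv]; apply/asboolP.
  exact: tensor_relation0.
exact: tensor_relationB.
Qed.

HB.instance Definition _ :=
  GRing.isZmodClosed.Build tensor_free tensor_relations tensor_relations_closed.

Definition tensor : zmodType := Quotient.quot tensor_relations.

Definition tensor_pi (u : tensor_free) : tensor := \pi_(tensor)%qT u.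

Lemma tensor_pi_eq (u v : tensor_free) :
  tensor_pi u = tensor_pi v <-> tensor_relation (u - v).
Proof.
have h : (tensor_pi u == tensor_pi v) = (u - v \in tensor_relations).
  by rewrite Quotient.idealrBE.
by split=> [/eqP|]; [rewrite h => /asboolP | move=> /asboolP r; apply/eqP; rewrite h].
Qed.

Lemma tensor_piD (u v : tensor_free) : tensor_pi (u + v) = tensor_pi u + tensor_pi v.
Proof. by rewrite /tensor_pi piE. Qed.

Lemma tensor_piN (u : tensor_free) : tensor_pi (- u) = - tensor_pi u.
Proof. by rewrite /tensor_pi piE. Qed.

Lemma tensor_pi_repr (t : tensor) : tensor_pi (repr t) = t.
Proof. exact: reprK. Qed.

Definition tens (e : E) (m : M) : tensor := tensor_pi (tensor_gen e m).

Definition balanced (G : zmodType) (f : E -> M -> G) :=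
  [/\ forall e e' m, f (e + e') m = f e m + f e' m,
      forall e m m', f e (m + m') = f e m + f e m' &
      forall e (r : R) m, f ((r : R^c) *: e) m = f e (r *: m)].

Lemma tens_balanced : balanced tens.
Proof.
by split=> *; rewrite /tens -?tensor_piD; apply/tensor_pi_eq;
  [exact: tensor_relationDl | exact: tensor_relationDr | exact: tensor_relationZ].
Qed.

Definition tensor_lift (G : zmodType) (f : E -> M -> G) (t : tensor) : G :=
  @fglift int (zmodule G) _ (fun p : E * M => f p.1 p.2) (repr t).

Section Lift.
Context (G : zmodType) (f : E -> M -> G).
Hypothesis f_balanced : balanced f.

Let free_lift (u : tensor_free) : G :=
  @fglift int (zmodule G) _ (fun p : E * M => f p.1 p.2) u.

Let free_liftB u v : free_lift (u - v) = free_lift u - free_lift v.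
Proof. exact: (@lift_is_additive int _ (zmodule G)). Qed.

Let free_lift0 : free_lift 0 = 0.
Proof. by rewrite -(subrr 0) free_liftB subrr. Qed.

Let free_liftD u v : free_lift (u + v) = free_lift u + free_lift v.
Proof.
by rewrite -{1}(opprK v) free_liftB -[- v]add0r free_liftB free_lift0 sub0r opprK.
Qed.

Let free_lift_gen e m : free_lift (tensor_gen e m) = f e m.
Proof. by rewrite /free_lift /tensor_gen liftU scale1r. Qed.

Let free_lift_rel u : tensor_relation u -> free_lift u = 0.
Proof.
have [fDl fDr fZ] := f_balanced.
elim=> [|{}u v _ hu _ hv|e e' m|e m m'|e r m].
- exact: free_lift0.
- by rewrite free_liftB hu hv subrr.
- by rewrite free_liftB free_liftD !free_lift_gen fDl subrr.
- by rewrite free_liftB free_liftD !free_lift_gen fDr subrr.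
- by rewrite free_liftB !free_lift_gen fZ subrr.
Qed.

Let tensor_liftE u : tensor_lift f (tensor_pi u) = free_lift u.
Proof.
apply/eqP; rewrite -subr_eq0 -[tensor_lift _ _]/(free_lift _) -free_liftB.
by apply/eqP/free_lift_rel/tensor_pi_eq; rewrite tensor_pi_repr.
Qed.

Lemma tensor_liftB : {morph tensor_lift f : t t' / t - t'}.
Proof.
move=> t t'; rewrite -[t]tensor_pi_repr -[t']tensor_pi_repr.
by rewrite -tensor_piN -tensor_piD !tensor_liftE free_liftB.
Qed.

Lemma tensor_lift_tens e m : tensor_lift f (tens e m) = f e m.
Proof. by rewrite tensor_liftE free_lift_gen. Qed.

End Lift.

Lemma tensor_ind (P : tensor -> Prop) :
  P 0 -> (forall t t', P t -> P t' -> P (t - t')) -> (forall e m, P (tens e m)) ->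
  forall t, P t.
Proof.
move=> P0 PB Pt t; rewrite -[t]tensor_pi_repr -[repr t]freeg_sumE.
have PD t1 t2 : P t1 -> P t2 -> P (t1 + t2).
  by move=> h1 h2; rewrite -[t2]opprK; apply/PB; rewrite // -sub0r; apply/PB.
have PN t1 : P t1 -> P (- t1) by move=> h; rewrite -sub0r; apply/PB.
have pi0 : tensor_pi 0 = 0 by rewrite -(subrr 0) tensor_piD tensor_piN subrr.
elim/big_ind: _ => [|u v|[e m] _]; first by rewrite pi0.
  by rewrite tensor_piD; apply/PD.
set c := coeff _ _.
have Pn n : P (tensor_pi << n%:Z *g (e, m) >>).
  elim: n => [|n IHn]; first by rewrite freegU0 pi0.
  have -> : << n.+1%:Z *g (e, m) >> = tensor_gen e m + << n%:Z *g (e, m) >>.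
    by rewrite /tensor_gen freegUD -intS.
  by rewrite tensor_piD; exact: PD (Pt e m) IHn.
case: c => n //; rewrite NegzE -freegUN tensor_piN; exact/PN.
Qed.

End Tensor.

(* 1_E (x) f, characterised by [tensor_map_tens] below. *)
Definition tensor_map (R : pzRingType) (E : lmodType R^c) (M N : lmodType R)
    (f : {linear M -> N}) : tensor E M -> tensor E N :=
  tensor_lift (fun e m => tens e (f m)).

Arguments tensor_map {R} E {M N} f t.

Section TensorMap.
Context (R : pzRingType) (E : lmodType R^c) (M N : lmodType R).
Context (f : {linear M -> N}).

Let map_balanced : balanced (fun (e : E) m => tens e (f m)).
Proof.
have [tDl tDr tZ] := @tens_balanced R E N.
by split=> *; rewrite ?linearD ?linearZ.
Qed.

Lemma tensor_mapB : {morph tensor_map E f : t t' / t - t'}.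
Proof. exact: tensor_liftB. Qed.

Lemma tensor_map_tens (e : E) m : tensor_map E f (tens e m) = tens e (f m).
Proof. exact: tensor_lift_tens. Qed.

End TensorMap.

Section Gorenstein.
Context (R : pzRingType).

(* A sequence of modules and linear maps indexed by the integers,             *)
(*   ... -> C (i + 2) -> C (i + 1) --diff i--> C i -> ...;                    *)
(* [diff i] has source C (i + 1) so that no transport along i - 1 + 1 = i is  *)
(* needed.  That consecutive maps compose to zero is part of exactness.       *)
Record zseq := ZSeq {
  zobj :> int -> lmodType R;
  diff : forall i : int, {linear zobj (i + 1) -> zobj i} }.

Definition exact_complex (C : zseq) :=
  forall i, exact_pair (diff C (i + 1)) (diff C i).

Definition complex_of_projectives (C : zseq) :=
  forall i, projective_module (C i).

(* M is isomorphic to the kernel of some differential of C. *)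
Definition syzygy (C : zseq) (M : lmodType R) :=
  exists (i : int) (f : {linear M -> C (i + 1)}),
    injective f /\ exact_pair f (diff C i).

Definition tensor_exact (E : lmodType R^c) (C : zseq) :=
  forall i, exact_pair (tensor_map E (diff C (i + 1)))
                       (tensor_map E (diff C i)).

(* Exactness of Hom_R(C i, Q) -> Hom_R(C (i + 1), Q) -> Hom_R(C (i + 2), Q).  *)
Definition hom_exact (C : zseq) (Q : lmodType R) :=
  forall (i : int) (phi : {linear C (i + 1) -> Q}),
    (forall x, phi (diff C (i + 1) x) = 0) <->
    exists psi : {linear C i -> Q}, forall x, psi (diff C i x) = phi x.

Definition PGF (M : lmodType R) := exists C : zseq,
  [/\ complex_of_projectives C, exact_complex C,
      forall E : lmodType R^c, injective_module E -> tensor_exact E C &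
      syzygy C M].

Definition gorenstein_projective (M : lmodType R) := exists C : zseq,
  [/\ complex_of_projectives C, exact_complex C,
      forall Q : lmodType R, projective_module Q -> hom_exact C Q &
      syzygy C M].

(* An exact sequence 0 -> G k -> ... -> G 0 -> M -> 0 with all terms PGF,     *)
(* extended to the left by zero modules.                                      *)
Definition PGF_resolution (M : lmodType R) (k : nat) :=
  exists (G : nat -> lmodType R) (d : forall n, {linear G n.+1 -> G n})
         (eps : {linear G 0 -> M}),
    [/\ forall n, (n <= k)%N -> PGF (G n),
        forall n, (k < n)%N -> forall x : G n, x = 0,
        is_surjective eps, exact_pair (d 0) eps &
        forall n, exact_pair (d n.+1) (d n)].

End Gorenstein.

(* Natural numbers extended by infinity, infinity being [None]. *)
Definition enat := option nat.
Definition infinity : enat := None.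

Definition le_enat (x y : enat) : bool :=
  match x, y with
  | _, None => true
  | None, Some _ => false
  | Some m, Some n => (m <= n)%N
  end.

(* The least natural number satisfying P, infinity if there is none. *)
Definition least (P : nat -> Prop) : enat :=
  match pselect (exists n, `[< P n >]) with
  | left exP => Some (ex_minn exP)
  | right _ => infinity
  end.

Lemma least_some P n :
  least P = Some n <-> P n /\ forall m, P m -> (n <= m)%N.
Proof.
rewrite /least; case: pselect => [exP|nP]; last first.
  by split=> // -[Pn _]; case: nP; exists n; apply/asboolP.
case: ex_minnP => k /asboolP Pk kmin.
split=> [[<-]|[Pn nmin]]; first by split=> // m Pm; apply/kmin/asboolP.
by congr Some; apply/eqP; rewrite eqn_leq nmin // kmin //; apply/asboolP.
Qed.

Lemma least_infinity P : least P = infinity <-> forall n, ~ P n.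
Proof.
rewrite /least; case: pselect => [exP|nP]; split=> //.
  by move=> h; exfalso; case: exP => n /asboolP; apply: h.
by move=> _ n Pn; apply: nP; exists n; apply/asboolP.
Qed.

(* Least upper bound: the least natural number bounding S, infinity if there  *)
(* is none.                                                                   *)
Definition esup (S : set enat) : enat :=
  least (fun n => forall x, S x -> le_enat x (Some n)).

Lemma esup_lub (S : set enat) y :
  le_enat (esup S) y <-> forall x, S x -> le_enat x y.
Proof.
case: y => [n|]; last by split=> [_ []|_] //; case: (esup S).
case eS: (esup S) => [s|]; last first.
  by split=> // h; case: (proj1 (least_infinity _) eS n).
have [ub lub] := proj1 (least_some _ _) eS; split=> /= [sn x /ub|/lub//].
by case: x => //= m ms; apply: leq_trans sn.
Qed.

Definition PGF_pd (R : pzRingType) (M : lmodType R) : enat :=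
  least (PGF_resolution M).

Definition PGFD (R : pzRingType) (X : lmodType R -> Prop) : enat :=
  esup [set k | exists M : lmodType R, X M /\ PGF_pd M = k].

(* Main.v *)
From HB Require Import structures.
Require Import Defs.
From mathcomp Require Import all_boot all_order all_algebra.
From mathcomp Require Import boolp classical_sets functions.

(** Let M be Gorenstein projective with a PGF resolution of finite length n; M
    turns out to be PGF, which is the dichotomy, and the supremum follows.

    The engine is the theorem that PGF modules are Gorenstein projective: a
    complex C of projectives with E (x) C exact for all injective E is also
    exact under Hom(-, X) for projective X ([tensor_exact_hom_exact]).  First,
    for finitely many a in C i there are finitely many y in C (i + 1) such that
    each phi : C i -> X killing every dy agrees with some psi o d on the a's
    ([finite_approximation]).  Indeed, if every finite Y had a bad phi_Y,
    characters X^n -> Q/Z separating (phi_Y a) from the group of all (psi d a)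
    would assemble, over all Y at once, into a tensor t in E (x) C, with E the
    product over Y of the character module X^+, injective as X is projective.
    Then (E (x) d) t = 0, so t is (E (x) d) u for some u; the finitely many
    elements in u form a Y_0, and pairing t with phi_{Y_0} gives both zero and a
    nonzero value.  Second, this finite solvability is a Mittag-Leffler
    condition.  Writing C through dual bases turns Hom(C, X) into a complex of
    functions on a set with a differential of finite range, where one solves
    psi o d = phi along a countable set by successive corrections, and along an
    arbitrary set by Zorn, adding countably many coordinates at a time
    ([local_cocycle_coboundary]).  Finite solvability itself must survive the
    passage to the coordinates still to be treated and to the enlarged set; this
    is a chase as in a short exact sequence of complexes.

    PGF and Gorenstein projective modules are then handled by coinduction: such
    a module is one from which short exact sequences with projective middle term
    and tensor-exact (resp. Hom(-, projective)-exact) inclusion can be continued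
    for ever in both directions ([PGF_coinduction]).

    The length n of the resolution is lowered as follows.  Let P be
    projective, mapping onto M with Gorenstein projective kernel A; let G_1 -> G_0
    be the start of the resolution, and P' projective, mapping onto G_0 with PGF
    kernel.
    Lifting P -> M to P -> G_0, the pullback W of G_1 + P -> G_0 <- P' is PGF
    ([PGF_pullback]; it is a syzygy of a mapping cone), and W, G_2, G_3, ...
    resolve A + P', a syzygy of M.  So by induction N := A + P' is PGF, and it
    remains to go from N to M = (P + P') / N ([gorenstein_PGF_step]).  Comparing
    the coresolution of N as a Gorenstein projective module with the one as a
    PGF module, both Hom(-, projective)-exact by the engine, shows that the
    inclusion of N is tensor-exact and that M is a retract of a PGF module; the
    same comparison repeats at each later cosyzygy of M, and coinduction
    applies. *)

Set Implicit Arguments.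
Unset Strict Implicit.
Unset Printing Implicit Defensive.

Import GRing.Theory Num.Theory.
Local Open Scope ring_scope.

(** * Cocycles of a differential of finite range *)

Lemma dependent_choice (T : Type) (P : nat -> T -> Prop)
    (R : nat -> T -> T -> Prop) (t0 : T) :
  P 0%N t0 -> (forall n t, P n t -> exists2 t', P n.+1 t' & R n t t') ->
  exists2 f : nat -> T, f 0%N = t0 & forall n, P n (f n) /\ R n (f n) (f n.+1).
Proof.
move=> P0 step.
have /choice[next nextP] : forall p : nat * T, exists t',
    P p.1 p.2 -> P p.1.+1 t' /\ R p.1 p.2 t'.
  case=> n t; have [/step[t' Pt' Rt']|nP] := pselect (P n t).
    by exists t'.
  by exists t.
pose f := fix f n := if n is m.+1 then next (m, f m) else t0.
have fP n : P n (f n) by elim: n => //= n /(nextP (n, f n)) [].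
by exists f => // n; split; [exact: fP | case: (nextP (n, f n) (fP n))].
Qed.

(** The model to keep in mind: B indexes coordinates of a complex L of free
    modules, [e] is the dual of an idempotent cutting out a complex of
    projectives, and [D] is the dual of its differential, so that [e]-invariant
    functions B -> X are the cochains with values in X.  Only the finite range
    of [e] and [D], recorded by [N], matters. *)
Section LocalCocycles.
Context (B : choiceType) (X : zmodType) (e D : (B -> X) -> (B -> X)).
Context (N : B -> seq B).
Implicit Types (S T : set B) (A Y : seq B) (phi psi chi : B -> X).

Hypothesis eB : forall phi psi, e (phi - psi) = e phi - e psi.
Hypothesis DB : forall phi psi, D (phi - psi) = D phi - D psi.
Hypothesis eN : forall b phi psi, {in N b, phi =1 psi} -> e phi b = e psi b.
Hypothesis DN : forall b phi psi, {in N b, phi =1 psi} -> D phi b = D psi b.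
Hypothesis ee : forall phi, e (e phi) = e phi.
Hypothesis De : forall phi, D (e phi) = D phi.
Hypothesis eD : forall phi, e (D phi) = D phi.
Hypothesis DD : forall phi, D (D phi) = 0.

Definition inside A S := forall a, a \in A -> S a.

Definition null_on S phi := forall b, S b -> phi b = 0.

Definition stable S := forall b, S b -> inside (N b) S.

(** Finite solvability for the coordinates in S' but not in S: these carry the
    functions vanishing on S, considered up to equality on S'.  This avoids
    forming the restricted function spaces. *)
Definition solvable_between S S' :=
  forall A, inside A S' -> exists2 Y, inside Y S' &
    forall phi, null_on S phi -> (forall b, S' b -> e phi b = phi b) ->
      (forall y, y \in Y -> D phi y = 0) ->
      exists2 psi, null_on S psi & forall a, a \in A -> D psi a = phi a.

Definition cut S phi : B -> X := fun b => if `[< S b >] then 0 else phi b.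

Lemma cut_null S phi : null_on S (cut S phi).
Proof. by move=> b Sb; rewrite /cut asboolT. Qed.

Lemma cutE S phi b : ~ S b -> cut S phi b = phi b.
Proof. by move=> Sb; rewrite /cut asboolF. Qed.

Lemma subfE (phi psi : B -> X) b : (phi - psi) b = phi b - psi b.
Proof. by []. Qed.

Lemma e0 : e 0 = 0. Proof. by have := eB 0 0; rewrite !subrr. Qed.
Lemma D0 : D 0 = 0. Proof. by have := DB 0 0; rewrite !subrr. Qed.

Lemma e_null S phi : stable S -> null_on S phi -> null_on S (e phi).
Proof.
move=> clS phi0 b Sb; rewrite (@eN b phi 0) ?e0// => c /(clS b Sb) Sc.
exact: phi0.
Qed.

Lemma D_null S phi : stable S -> null_on S phi -> null_on S (D phi).
Proof.
move=> clS phi0 b Sb; rewrite (@DN b phi 0) ?D0// => c /(clS b Sb) Sc.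
exact: phi0.
Qed.

Lemma null_sub S phi psi : null_on S phi -> null_on S psi -> null_on S (phi - psi).
Proof. by move=> h k b Sb; rewrite subfE h// k// subrr. Qed.

(** The coordinates in S that enter the values of [e] and [D] on A. *)
Definition dependencies S (A : seq B) : seq B := [seq c <- flatten (map N A) | `[< S c >]].

Lemma dependenciesP S A a c : a \in A -> c \in N a -> S c -> c \in dependencies S A.
Proof.
move=> aA ca Sc; rewrite mem_filter asboolT//=.
by apply/flattenP; exists (N a) => //; apply: map_f.
Qed.

Lemma dependencies_inside S A : inside (dependencies S A) S.
Proof. by move=> c; rewrite mem_filter => /andP[/asboolP]. Qed.

Lemma inside_cat A Y S : inside A S -> inside Y S -> inside (A ++ Y) S.
Proof. by move=> h k a; rewrite mem_cat => /orP[/h|/k]. Qed.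

(** As in the long exact sequence of a quotient: a solution psi on S' need not
    vanish on S, but psi restricted to S is there a cocycle up to finitely many
    coordinates, so finite solvability on S lets one subtract a coboundary and
    make psi vanish wherever A can see it. *)
Lemma solvable_quotient S S' : (forall b, S b -> S' b) ->
  solvable_between set0 S -> solvable_between set0 S' ->
  stable S' -> solvable_between S S'.
Proof.
move=> SS' solS solS' clS' A AS'.
have [Y' Y'S Y'P] := solS (dependencies S A) (@dependencies_inside _ _).
have [|Y YS' YP] := solS' (A ++ Y').
  by apply: inside_cat => // y /Y'S /SS'.
exists Y => // phi phi0 ephi Dphi.
have [psi _ psiP] := YP phi (fun b => False_ind _) ephi Dphi.
have [||chi _ chiP] := Y'P (e psi) (fun b => False_ind _).
- by move=> b _; rewrite ee.
- move=> y Yy; rewrite De psiP ?mem_cat ?Yy ?orbT//.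
  exact/phi0/Y'S.
exists (cut S (e psi - D chi)); first exact: cut_null.
move=> a Aa; rewrite -psiP ?mem_cat ?Aa//.
rewrite (@DN a _ (e psi - D chi)) ?DB ?DD ?subr0 ?De// => c ca.
have [Sc|Sc] := pselect (S c); last by rewrite cutE.
by rewrite cut_null// subfE chiP ?subrr//; apply: dependenciesP ca Sc.
Qed.

(** As for an extension of complexes: first solve on S near A, then treat the
    difference, which can be made to vanish on S without changing it near A. *)
Lemma solvable_extension S S' : (forall b, S b -> S' b) -> stable S -> stable S' ->
  solvable_between set0 S -> solvable_between S S' -> solvable_between set0 S'.
Proof.
move=> SS' clS clS' solS solSS' A AS'.
have [Y1 Y1S' Y1P] := solSS' A AS'.
have [Y2 Y2S Y2P] := solS (dependencies S (A ++ Y1)) (@dependencies_inside _ _).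
exists (Y1 ++ Y2); first by apply: inside_cat => // y /Y2S /SS'.
move=> phi _ ephi Dphi.
have [||chi _ chiP] := Y2P phi (fun b => False_ind _).
- by move=> b /SS' /ephi.
- by move=> y Yy; apply: Dphi; rewrite mem_cat Yy orbT.
pose rho := phi - D chi.
have cut_rho a : a \in A ++ Y1 -> {in N a, cut S rho =1 rho}.
  move=> Aa c ca; have [Sc|Sc] := pselect (S c); last by rewrite cutE.
  by rewrite cut_null// /rho subfE chiP ?subrr//; apply: dependenciesP ca Sc.
have [|||psi psi0 psiP] := Y1P (e (cut S rho)).
- by apply: e_null => //; exact: cut_null.
- by move=> b _; rewrite ee.
- move=> y Yy; rewrite De (@DN _ _ rho); last first.
    by apply: cut_rho; rewrite mem_cat Yy orbT.
  by rewrite /rho DB DD subr0 Dphi ?mem_cat ?Yy.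
exists (psi + chi) => // a Aa.
have -> : psi + chi = psi - (0 - chi) by rewrite sub0r opprK.
rewrite DB DB D0 sub0r opprK.
rewrite -[LHS]/(D psi a + D chi a) psiP// (@eN _ _ rho); last first.
  by apply: cut_rho; rewrite mem_cat Aa.
rewrite /rho eB eD subfE ephi ?subrK//; exact: AS'.
Qed.

(** The Mittag-Leffler argument.  With A n the first n coordinates, psi_n solves
    the equation on a finite set Z n containing the set Y n that controls A n.
    A new solution psi' on Z (n + 1) differs from psi_n by a function that is a
    cocycle on Y n, hence a coboundary on A n; correcting psi' by it gives a
    psi_{n+1} that agrees with psi_n on A n, and the psi_n converge. *)
Lemma solve_countable S S' (tau : nat -> B) phi :
  stable S -> stable S' -> (forall n, S' (tau n)) ->
  (forall b, S' b -> S b \/ exists n, tau n = b) ->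
  solvable_between S S' -> null_on S phi -> e phi = phi -> D phi = 0 ->
  exists2 psi, null_on S psi & forall b, S' b -> D psi b = phi b.
Proof.
move=> clS clS' tauS' S'tau sol phi0 ephi Dphi.
pose A n := map tau (iota 0 n).
have AS' n : inside (A n) S' by move=> _ /mapP[k _ ->].
have /choice[Y YP] : forall n, exists Y, inside Y S' /\
    forall phi, null_on S phi -> (forall b, S' b -> e phi b = phi b) ->
      (forall y, y \in Y -> D phi y = 0) ->
      exists2 psi, null_on S psi & forall a, a \in A n -> D psi a = phi a.
  move=> n; have [Y YS' YP] := sol (A n) (AS' n); by exists Y; split.
pose Z := fix Z n := A n ++ Y n ++ (if n is m.+1 then Z m else [::]).
have ZS' n : inside (Z n) S'.
  by elim: n => [|n IHn]; apply: (inside_cat (AS' _));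
    apply: (inside_cat (YP _).1).
have ZE n a : (a \in Z n) =
    [|| a \in A n, a \in Y n | if n is m.+1 then a \in Z m else false].
  by case: n => [|n]; rewrite -?[Z n.+1]/(A n.+1 ++ Y n.+1 ++ Z n)
    -?[Z 0%N]/(A 0%N ++ Y 0%N ++ [::]) !mem_cat.
have AZ n : {subset A n <= Z n} by move=> a Aa; rewrite ZE Aa.
have YZ n : {subset Y n <= Z n} by move=> a Ya; rewrite ZE Ya orbT.
have ZZ n : {subset Z n <= Z n.+1} by move=> a Za; rewrite ZE Za !orbT.
pose P n psi := [/\ null_on S psi, e psi = psi &
  forall a, a \in Z n -> D psi a = phi a].
have start n : exists psi, P n psi.
  have [W _ WP] := sol (Z n) (ZS' n).
  have [||psi psi0 psiP] := WP phi phi0; first by move=> b _; rewrite ephi.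
    by move=> y _; rewrite Dphi.
  exists (e psi); split; [exact: e_null|exact: ee|].
  by move=> a Za; rewrite De psiP.
have [psi0 Ppsi0] := start 0%N.
have [|f _ fP] := @dependent_choice _ P
    (fun n psi psi' => {in A n, psi =1 psi'}) psi0 Ppsi0.
  move=> n psi [psi_null epsi Dpsi]; have [psi' [psi'_null epsi' Dpsi']] := start n.+1.
  have [||chi chi_null chiP] := (YP n).2 _ (null_sub psi'_null psi_null).
  - by move=> b _; rewrite eB epsi' epsi.
  - by move=> y /YZ Zy; rewrite DB subfE Dpsi ?Dpsi' ?subrr//; apply: ZZ.
  exists (psi' - D chi).
    split; first by apply: null_sub => //; apply: D_null.
      by rewrite eB epsi' eD.
    by move=> a Za; rewrite DB DD subr0 Dpsi'.
  by move=> a Aa; rewrite subfE chiP// subfE opprB addrC subrK.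
have fA m n a : (m <= n)%N -> a \in A m -> f m a = f n a.
  move=> /subnKC <-; elim: (n - m)%N => [|k IHk] Aa; first by rewrite addn0.
  rewrite addnS IHk//; apply: (fP _).2; apply/mapP.
  have /mapP[i + ->] := Aa; rewrite mem_iota/= add0n => ltim.
  by exists i => //; rewrite mem_iota/= add0n ltn_addr.
have /choice[idx idxP] : forall b, exists n, S' b -> ~ S b -> tau n = b.
  move=> b.
  have [/S'tau[|[n <-]]|] := pselect (S' b); [|by exists n|by exists 0%N].
  by exists 0%N.
have inA b n : S' b -> ~ S b -> (idx b < n)%N -> b \in A n.
  move=> S'b Sb lt; apply/mapP; exists (idx b); last by rewrite idxP.
  by rewrite mem_iota.
pose psi := cut S (fun b => f (idx b).+1 b).
have psiE b n : S' b -> (idx b < n)%N -> psi b = f n b.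
  move=> S'b lt; have [Sb|Sb] := pselect (S b).
    by have [[fn _ _] _] := fP n; rewrite /psi cut_null ?fn.
  by rewrite /psi cutE//; apply: fA => //; apply: inA.
exists psi; first exact: cut_null.
move=> b S'b; pose n := (\max_(c <- b :: N b) idx c).+1.
have ltn_n c : c \in b :: N b -> (idx c < n)%N.
  by move=> cb; rewrite ltnS; apply: leq_bigmax_seq.
have [Sb|Sb] := pselect (S b).
  by rewrite phi0// (D_null clS _ Sb)//; exact: cut_null.
have [[_ _ fD] _] := fP n.
rewrite -fD; last by apply/AZ/inA => //; apply/ltn_n/mem_head.
apply: DN => c cb; apply: psiE; first exact: clS' cb.
by apply: ltn_n; rewrite inE cb orbT.
Qed.

(** Applying Y to the lists of a single increasing exhaustion suffices, since
    every finite part of the union lies in one of these lists; that is why the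
    closure is stated for some A' containing A. *)
Lemma countable_closure b (Y : seq B -> seq B) :
  exists tau : nat -> B, [/\ exists n, tau n = b,
    forall n c, c \in N (tau n) -> exists m, tau m = c &
    forall A, (forall a, a \in A -> exists m, tau m = a) ->
      exists2 A' : seq B, {subset A <= A'} & forall y, y \in Y A' -> exists m, tau m = y].
Proof.
pose L := fix L n := if n is m.+1 then
  L m ++ flatten (map N (L m)) ++ Y (L m) else [:: b].
have LS n : {subset L n <= L n.+1} by move=> a La; rewrite /= mem_cat La.
have LL m n : (m <= n)%N -> {subset L m <= L n}.
  by move=> /subnKC <-; elim: (n - m)%N => [|k IHk] a La;
    rewrite ?addn0 ?addnS//; apply/LS/IHk.
pose tau m := if unpickle m is Some (n, i) then nth b (L n) i else b.
have tauP c : (exists m, tau m = c) <-> exists n, c \in L n.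
  split=> [[m <-]|[n Lc]]; last first.
    by exists (pickle (n, index c (L n))); rewrite /tau pickleK nth_index.
  rewrite /tau; case: (unpickle m) => [[n i]|]; last first.
    by exists 0%N; rewrite mem_head.
  have [lt|ge] := ltnP i (size (L n)); first by exists n; rewrite mem_nth.
  by exists 0%N; rewrite nth_default// mem_head.
exists tau; split.
- by apply/tauP; exists 0%N; rewrite mem_head.
- move=> n c cn; apply/tauP; have /tauP[m Lm] : exists k, tau k = tau n by exists n.
  exists m.+1; rewrite /= !mem_cat; apply/orP; right; apply/orP; left.
  by apply/flattenP; exists (N (tau n)) => //; apply: map_f.
move=> A Atau; have [n An] : exists n, {subset A <= L n}.
  elim: A Atau => [|a A IHA] Atau; first by exists 0%N.
  have [n An] : exists n, {subset A <= L n}.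
    by apply: IHA => c cA; apply: Atau; rewrite inE cA orbT.
  have /tauP[m am] := Atau a (mem_head _ _).
  exists (maxn n m) => c; rewrite inE => /orP[/eqP->|/An].
    exact: LL (leq_maxr _ _) _ am.
  exact: LL (leq_maxl _ _) _.
exists (L n) => // y Yy; apply/tauP; exists n.+1.
by rewrite /= !mem_cat Yy !orbT.
Qed.

(** The closure is taken with respect to solvability on the complement of S, so
    that the new coordinates do not have to control those of S. *)
Lemma countable_step S b : stable S -> solvable_between set0 S ->
  solvable_between set0 [set: B] ->
  exists S', [/\ S' b, (forall c, S c -> S' c), stable S', solvable_between S S' &
    exists2 tau : nat -> B, (forall n, S' (tau n)) &
      forall c, S' c -> S c \/ exists n, tau n = c].
Proof.
move=> clS solS solB.
have clT : stable [set: B] by [].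
have solSB : solvable_between S [set: B] by apply: solvable_quotient.
have /choice[Y YP] : forall A, exists Y, forall phi, null_on S phi ->
    e phi = phi -> (forall y, y \in Y -> D phi y = 0) ->
    exists2 psi, null_on S psi & forall a, a \in A -> D psi a = phi a.
  move=> A; have [//|Y _ YP] := solSB A; exists Y => phi phi0 ephi.
  by apply: YP => // c _; rewrite ephi.
have [tau [taub tauN tauY]] := countable_closure b Y.
pose S' : set B := fun c => S c \/ exists n, tau n = c.
have clS' : stable S'.
  move=> c [Sc|[n <-]] d dc; first by left; exact: clS dc.
  by right; exact: tauN dc.
exists S'; split => //; [by right|by left| |]; last first.
  by exists tau => // n; right; exists n.
move=> A AS'; pose A1 := [seq a <- A | ~~ `[< S a >]].
have [|A2 A12 YA2] := tauY A1.
  by move=> a; rewrite mem_filter => /andP[/asboolPn Sa /AS'[]].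
exists (Y A2); first by move=> y /YA2; right.
move=> phi phi0 ephi Dphi.
(* [phi] is invariant on S' only; [rho] is a globally invariant replacement. *)
pose rho := e (cut (~` S') phi).
have cut_phi c : S' c -> {in N c, cut (~` S') phi =1 phi}.
  by move=> S'c d dc; rewrite cutE// => /(_ (clS' _ S'c _ dc)).
have rhoE c : S' c -> rho c = phi c.
  by move=> S'c; rewrite -ephi// /rho; apply: eN; apply: cut_phi.
have [||y Yy|psi psi0 psiP] := YP A2 rho.
- by move=> c Sc; rewrite rhoE ?phi0//; left.
- exact: ee.
- rewrite De -(Dphi y Yy); apply: DN; apply: cut_phi; right; exact: YA2.
exists psi => // a Aa; have [Sa|Sa] := pselect (S a).
  by rewrite phi0//; apply: D_null Sa.
rewrite psiP ?rhoE//; first exact: AS'.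
by apply: A12; rewrite mem_filter Aa asboolF.
Qed.

(** Zorn's lemma on the pairs (S, psi) where S is stable with finite
    solvability and psi solves the equation on S.  Finite solvability passes to
    unions of chains because it only speaks of finite sets, and the countable
    case enlarges any proper S. *)
Theorem local_cocycle_coboundary phi : solvable_between set0 [set: B] ->
  e phi = phi -> D phi = 0 -> exists psi, D psi = phi.
Proof.
move=> solB ephi Dphi.
pose good (p : set B * (B -> X)) := [/\ stable p.1, solvable_between set0 p.1 &
  forall b, p.1 b -> D p.2 b = phi b].
pose le (p q : {p | good p}) := (forall b, (sval p).1 b -> (sval q).1 b) /\
  forall b, (sval p).1 b -> (sval q).2 b = (sval p).2 b.
have good0 : good (set0, 0).
  split=> //; move=> A A0; exists [::] => // rho _ _ _.
  by exists 0 => // a /A0.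
have [p pmax] : exists p, premaximal le p.
  pose R p q := `[< le p q >].
  have [|||p pmax] := @ZL_preorder _ (exist good _ good0) R.
  - by move=> p; apply/asboolP.
  - move=> q p r /asboolP[pq1 pq2] /asboolP[qr1 qr2]; apply/asboolP; split.
      by move=> b /pq1 /qr1.
    by move=> b pb; rewrite qr2 ?pq2//; apply: pq1.
  - move=> C Ctot.
    pose S : set B := fun b => exists2 p, C p & (sval p).1 b.
    have /choice[psi psiP] : forall b, exists x,
        forall p, C p -> (sval p).1 b -> x = (sval p).2 b.
      move=> b; have [[p Cp pb]|nS] := pselect (S b); last first.
        by exists 0 => p Cp pb; case: nS; exists p.
      exists ((sval p).2 b) => q Cq qb.
      by have [/asboolP[_ ->]|/asboolP[_ ->]] := Ctot p q Cp Cq.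
    have Sfin A : inside A S -> A = [::] \/ exists2 p, C p & inside A (sval p).1.
      elim: A => [|a A IHA] AS; first by left.
      have [p Cp pa] := AS a (mem_head _ _); right.
      have [|->|[q Cq qA]] := IHA; first by move=> c cA; apply: AS; rewrite inE cA orbT.
        by exists p => // c; rewrite inE => /eqP->.
      have [/asboolP[pq _]|/asboolP[qp _]] := Ctot p q Cp Cq.
        by exists q => // c; rewrite inE => /orP[/eqP->|/qA//]; apply: pq.
      by exists p => // c; rewrite inE => /orP[/eqP->//|/qA]; apply: qp.
    have gS : good (S, psi).
      split=> /=.
      - move=> b [p Cp pb] c cb; exists p => //.
        by have [clp _ _] := svalP p; exact: clp cb.
      - move=> A /Sfin[->|[p Cp pA]].
          by exists [::] => // rho _ _ _; exists 0.
        have [_ solp _] := svalP p; have [Y Yp YP] := solp A pA.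
        exists Y => [y /Yp|rho rho0 erho Drho]; first by exists p.
        by apply: YP => // b pb; apply: erho; exists p.
      - move=> b [p Cp pb]; have [clp _ <-//] := svalP p.
        apply: DN => c cb; apply: psiP => //; exact: clp cb.
    exists (exist good _ gS) => p Cp; apply/asboolP; split=> b pb /=.
      by exists p.
    exact: psiP.
  by exists p => q pq; apply/asboolP/pmax/asboolP.
case: p pmax => -[S psi] gp pmax; have [/= clS solS Dpsi] := gp.
suff ST b : S b by exists psi; apply/funext => b; exact: Dpsi.
apply: contrapT => nSb.
have [S' [S'b SS' clS' solSS' [tau tauS' S'tau]]] := countable_step b clS solS solB.
pose rho := phi - D psi.
(* After subtracting the coboundary of psi, the cocycle lives off S. *)
have [|||chi chi0 chiP] := solve_countable clS clS' tauS' S'tau solSS' (phi := rho).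
- by move=> c Sc; rewrite /rho subfE Dpsi ?subrr.
- by rewrite /rho eB eD ephi.
- by rewrite /rho DB DD Dphi subrr.
have gp' : good (S', psi - (0 - chi)).
  split=> //=; first exact: solvable_extension solSS'.
  move=> c S'c; rewrite DB DB D0 sub0r opprK -[LHS]/(D psi c + D chi c) chiP//.
  by rewrite /rho subfE addrC subrK.
apply: nSb; have [|h _] := pmax (exist good _ gp'); last exact: h.
split=> //= c Sc; rewrite !subfE chi0//.
by rewrite -[(0 : B -> X) c]/(0 : X) !subr0.
Qed.

End LocalCocycles.

(** * Characters with values in Q/Z *)

Lemma additive_exists (U V : zmodType) (f : U -> V) :
  {morph f : x y / x - y} -> exists g : {additive U -> V}, g =1 f.
Proof.
move=> fB; pose m := GRing.isZmodMorphism.Build U V f fB.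
pose g : {additive U -> V} := HB.pack f m.
by exists g.
Qed.

Lemma subrACA (V : zmodType) (a b c d : V) : a - b - (c - d) = a - c - (b - d).
Proof. by rewrite !opprD addrACA. Qed.

Section PartialMorphism.
Context (G V : zmodType).

(** Partial morphisms are encoded by their graphs, which makes unions of chains
    and the adjunction of an element immediate. *)
Definition partial_morphism (Gamma : G -> V -> Prop) :=
  [/\ Gamma 0 0,
      forall x y u v, Gamma x u -> Gamma y v -> Gamma (x - y) (u - v) &
      forall v, Gamma 0 v -> v = 0].

Section Theory.
Context (Gamma : G -> V -> Prop) (GammaP : partial_morphism Gamma).

Lemma partialN x u : Gamma x u -> Gamma (- x) (- u).
Proof.
by have [G0 GB _] := GammaP; move=> xu; rewrite -sub0r -[- u]sub0r; apply: GB.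
Qed.

Lemma partialD x y u v : Gamma x u -> Gamma y v -> Gamma (x + y) (u + v).
Proof.
have [_ GB _] := GammaP => xu /partialN yv.
by rewrite -[y]opprK -[v]opprK; apply: GB.
Qed.

Lemma partialMn x u n : Gamma x u -> Gamma (x *+ n) (u *+ n).
Proof.
have [G0 _ _] := GammaP => xu; elim: n => [|n IHn]; first by rewrite !mulr0n.
by rewrite !mulrS; apply: partialD.
Qed.

Lemma partial_unique x u v : Gamma x u -> Gamma x v -> u = v.
Proof.
have [_ GB G1] := GammaP => xu xv; apply/eqP; rewrite -subr_eq0; apply/eqP/G1.
by rewrite -(subrr x); apply: GB.
Qed.

(** The value v at g must satisfy n v = Gamma (n g) for all n such that n g is in
    the domain.  These n are the multiples of the least positive one, where v is
    found by divisibility. *)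
Lemma partial_adjoin g : (forall n v, (0 < n)%N -> exists w : V, w *+ n = v) ->
  exists2 Delta, partial_morphism Delta &
    (forall x u, Gamma x u -> Delta x u) /\ exists v, Delta g v.
Proof.
move=> divV; have [G0 GB G1] := GammaP.
pose I n := (0 < n)%N /\ exists w, Gamma (g *+ n) w.
have [v vP] : exists v, forall n w, Gamma (g *+ n) w -> w = v *+ n.
  have [exI|noI] := pselect (exists n, `[< I n >]); last first.
    exists 0 => -[|n] w gw; first by rewrite mulr0n; apply: G1; rewrite -(mulr0n g).
    by case: noI; exists n.+1; apply/asboolP; split=> //; exists w.
  have [n /asboolP[n0 [w gw]] nmin] := ex_minnP exI.
  have [v vn] := divV n w n0; exists v => m z gz.
  have gr : Gamma (g *+ (m %% n)) (z - w *+ (m %/ n)).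
    have -> : g *+ (m %% n) = g *+ m - g *+ n *+ (m %/ n).
      by rewrite -mulrnA {2}(divn_eq m n) mulrnDr mulnC addrAC subrr add0r.
    by apply: GB => //; apply: partialMn.
  have r0 : (m %% n)%N = 0%N.
    apply/eqP; rewrite eqn0Ngt; apply/negP => r0.
    have : (n <= m %% n)%N by apply/nmin/asboolP; split=> //; exists (z - w *+ (m %/ n)).
    by rewrite leqNgt ltn_mod n0.
  move: gr; rewrite r0 mulr0n => /G1/eqP; rewrite subr_eq0 => /eqP->.
  by rewrite -vn -mulrnA {2}(divn_eq m n) r0 addn0 mulnC.
have {vP} vP (k : int) w : Gamma (g *~ k) w -> w = v *~ k.
  case: k => [n /vP//|n]; rewrite NegzE !mulrNz => /partialN.
  by rewrite opprK => /vP h; rewrite -[v *~ _]/(v *+ n.+1) -h opprK.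
exists (fun x y => exists k : int, Gamma (x - g *~ k) (y - v *~ k)).
  split.
  - by exists 0; rewrite !mulr0z !subr0.
  - move=> x y u w [k xu] [l yw]; exists (k - l); rewrite !mulrzBr.
    by rewrite subrACA [in X in Gamma _ X]subrACA; apply: GB.
  - move=> w [k]; rewrite sub0r => /partialN; rewrite opprK => /vP/eqP.
    by rewrite opprB eq_sym -subr_eq0 opprB addrC subrK => /eqP.
split; first by move=> x u xu; exists 0; rewrite !mulr0z !subr0.
by exists v, 1; rewrite !mulr1z !subrr.
Qed.

End Theory.

Lemma partial_morphism_extends (Gamma : G -> V -> Prop) :
  (forall n v, (0 < n)%N -> exists w : V, w *+ n = v) ->
  partial_morphism Gamma ->
  exists chi : {additive G -> V}, forall x u, Gamma x u -> chi x = u.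
Proof.
move=> divV GammaP.
pose good Delta := partial_morphism Delta /\ forall x u, Gamma x u -> Delta x u.
have good0 : good Gamma by [].
pose R (p q : {Delta | good Delta}) := `[< forall x u, sval p x u -> sval q x u >].
have [|||p pmax] := @ZL_preorder _ (exist good _ good0) R.
- by move=> p; apply/asboolP.
- by move=> q p r /asboolP pq /asboolP qr; apply/asboolP => x u /pq/qr.
- move=> C Ctot; have [[p0 Cp0]|C0] := pselect (exists p, C p); last first.
    by exists (exist good _ good0) => p Cp; case: C0; exists p.
  pose U x u := exists2 p, C p & sval p x u.
  have gU : good U.
    split; last by move=> x u xu; exists p0 => //; apply: (svalP p0).2.
    split.
    - by exists p0 => //; have [[]] := svalP p0.
    - move=> x y u v [p Cp xu] [q Cq yv].
      have [/asboolP pq|/asboolP qp] := Ctot p q Cp Cq.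
        by exists q => //; have [[_ qB _] _] := svalP q; apply: qB => //; apply: pq.
      by exists p => //; have [[_ pB _] _] := svalP p; apply: pB => //; apply: qp.
    - by move=> v [p Cp]; have [[_ _ p1] _] := svalP p; apply: p1.
  by exists (exist good _ gU) => p Cp; apply/asboolP => x u xu; exists p.
case: p pmax => Delta gD pmax; have [DP GD] := gD.
have /choice[chi chiP] : forall x, exists u, Delta x u.
  move=> x; have [Delta' DP' [DD' [v xv]]] := partial_adjoin DP x divV.
  have gD' : good Delta' by split=> // y u /GD/DD'.
  exists v; have /asboolP h : R (exist good _ gD') (exist good _ gD).
    by apply: pmax; apply/asboolP.
  exact: h.
have [h hE] : exists h : {additive G -> V}, h =1 chi.
  apply: additive_exists => x y; apply: (partial_unique DP (chiP _)).
  by have [_ DB _] := DP; apply: DB.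
by exists h => x u /GD xu; rewrite hE; apply: (partial_unique DP (chiP x)).
Qed.

End PartialMorphism.

Definition rat_integers : {pred rat} := fun q => q \is a Num.int.

Lemma rat_integers_closed : zmod_closed rat_integers.
Proof.
by split=> [|x y]; rewrite /rat_integers ?inE => *; [exact: rpred0|exact: rpredB].
Qed.

HB.instance Definition _ :=
  GRing.isZmodClosed.Build rat rat_integers rat_integers_closed.

Definition QZ : zmodType := Quotient.quot rat_integers.

Definition QZ_pi (q : rat) : QZ := \pi_(QZ)%qT q.

Lemma QZ_pi_eq0 q : (QZ_pi q == 0) = (q \is a Num.int).
Proof.
have -> : (0 : QZ) = QZ_pi 0 by rewrite /QZ_pi piE.
have -> : (QZ_pi q == QZ_pi 0) = (q - 0 \in rat_integers).
  by rewrite Quotient.idealrBE.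
by rewrite subr0.
Qed.

Lemma QZ_piMn q n : QZ_pi (q *+ n) = QZ_pi q *+ n.
Proof.
by elim: n => [|n IHn]; rewrite ?mulr0n ?mulrS -?IHn /QZ_pi piE.
Qed.

Lemma QZ_divisible n (v : QZ) : (0 < n)%N -> exists w : QZ, w *+ n = v.
Proof.
move=> n0; exists (QZ_pi (repr v / n%:R)).
rewrite -QZ_piMn (_ : _ *+ n = repr v); first exact: reprK.
by rewrite -[LHS]mulr_natr divfK// pnatr_eq0 -lt0n.
Qed.

Lemma QZ_injective (A B : zmodType) (i : {additive A -> B}) (f : {additive A -> QZ}) :
  injective i -> exists h : {additive B -> QZ}, forall x, h (i x) = f x.
Proof.
move=> iI; pose Gamma b u := exists2 a, i a = b & f a = u.
have [||h hP] := @partial_morphism_extends _ _ Gamma.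
- exact: QZ_divisible.
- split.
  + by exists 0; rewrite raddf0.
  + by move=> _ _ _ _ [a <- <-] [b <- <-]; exists (a - b); rewrite raddfB.
  + by move=> _ [a ia <-]; rewrite (_ : a = 0) ?raddf0//; apply: iI; rewrite raddf0.
by exists h => x; apply: hP; exists x.
Qed.

(** Start from the character on S + Z g that kills S and sends g to v, where v is
    1/n for n the order of g modulo S, or 1/2 if this order is infinite. *)
Lemma QZ_separates (G : zmodType) (S : G -> Prop) (g : G) :
  S 0 -> (forall x y, S x -> S y -> S (x - y)) -> ~ S g ->
  exists2 chi : {additive G -> QZ}, forall x, S x -> chi x = 0 & chi g != 0.
Proof.
move=> S0 SB nSg.
have SMn n x : S x -> S (x *+ n).
  move=> Sx; elim: n => [|n IHn]; first by rewrite mulr0n.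
  have -> : x *+ n.+1 = x *+ n - (0 - x) by rewrite sub0r opprK mulrSr.
  by apply: (SB) => //; apply: SB.
have [v v0 vP] : exists2 v : QZ, v != 0 & forall n, S (g *+ n) -> v *+ n = 0.
  have [exI|noI] := pselect (exists n, (0 < n)%N && `[< S (g *+ n) >]); last first.
    exists (QZ_pi (2%:R^-1)).
      by rewrite QZ_pi_eq0.
    move=> [|n] Sn; first by rewrite mulr0n.
    by case: noI; exists n.+1; rewrite asboolT.
  have [n /andP[n0 /asboolP Sn] nmin] := ex_minnP exI.
  have n1 : (1 < n)%N.
    by case: n n0 Sn {nmin} => [|[|n]]// _; rewrite mulr1n.
  exists (QZ_pi (n%:R^-1)).
    rewrite QZ_pi_eq0; apply/negP => /intrP[k kn].
    have /(@intr_inj rat) kn1 : (k * n%:Z)%:~R = 1%:~R :> rat.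
      by rewrite intrM -kn mulVf// pnatr_eq0 -lt0n.
    have /eqP := congr1 absz kn1; rewrite abszM muln_eq1 => /andP[_ /eqP n1'].
    by move: n1; rewrite -[n]/(absz n) n1'.
  move=> m Sm; have r0 : (m %% n)%N = 0%N.
    apply/eqP; rewrite eqn0Ngt; apply/negP => r0.
    have : (n <= m %% n)%N.
      apply: nmin; rewrite r0; apply/asboolP.
      have -> : g *+ (m %% n) = g *+ m - g *+ n *+ (m %/ n).
        by rewrite -mulrnA {2}(divn_eq m n) mulrnDr mulnC addrAC subrr add0r.
      by apply: SB => //; apply: SMn.
    by rewrite leqNgt ltn_mod n0.
  rewrite (divn_eq m n) r0 addn0 mulnC mulrnA -QZ_piMn (_ : n%:R^-1 *+ n = 1); last first.
    by rewrite -[LHS]mulr_natr mulVf// pnatr_eq0 -lt0n.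
  rewrite (_ : QZ_pi 1 = 0) ?mul0rn//.
  by apply/eqP; rewrite QZ_pi_eq0 rpred1.
pose Gamma x (u : QZ) := exists k : int, S (x - g *~ k) /\ u = v *~ k.
have PG : partial_morphism Gamma.
  split.
  - by exists 0; rewrite !mulr0z subr0.
  - move=> x y u w [k [xk ->]] [l [yl ->]]; exists (k - l); rewrite !mulrzBr; split=> //.
    by rewrite subrACA; apply: SB.
  - move=> _ [k [Sk ->]]; move: Sk; rewrite sub0r.
    case: k => n; rewrite ?NegzE ?mulrNz ?opprK => Sn.
      rewrite -pmulrn vP//; move: (SB _ _ S0 Sn); by rewrite sub0r opprK.
    by rewrite -pmulrn vP ?oppr0.
have [|chi chiP] := partial_morphism_extends _ PG; first exact: QZ_divisible.
exists chi; last by rewrite (chiP g v)//; exists 1; rewrite !mulr1z subrr.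
by move=> x Sx; apply: chiP; exists 0; rewrite !mulr0z subr0.
Qed.

(** * Submodules *)

Lemma linear_exists (S : pzRingType) (U V : lmodType S) (f : U -> V) :
  (forall a x y, f (a *: x + y) = a *: f x + f y) ->
  exists g : {linear U -> V}, g =1 f.
Proof.
move=> fL; pose m := GRing.isLinear.Build S U V *:%R f fL.
pose g : {linear U -> V} := HB.pack f m.
by exists g.
Qed.

Section Submodule.
Context (R : pzRingType) (V : lmodType R).

(** Submodules are bundled so that the module structure on the subtype can be
    declared once, for classical predicates. *)
Record submodule := Submodule {
  carrier : V -> Prop;
  submodule_closed : submod_closed (fun v => `[< carrier v >]) }.

Definition submodule_pred (S : submodule) : {pred V} := fun v => `[< carrier S v >].

Definition submodule_type (S : submodule) := {v : V | v \in submodule_pred S}.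

HB.instance Definition _ S := [isSub of submodule_type S for sval].
HB.instance Definition _ S := [Choice of submodule_type S by <:].
HB.instance Definition _ S := GRing.SubChoice_isSubLmodule.Build R V
  (submodule_pred S) (submodule_type S)
  (GRing.submod_closed_semi (submodule_closed S)).

End Submodule.

Lemma submodule_exists (R : pzRingType) (V : lmodType R) (S : V -> Prop) :
  S 0 -> (forall a u v, S u -> S v -> S (a *: u + v)) ->
  exists (W : lmodType R) (i : {linear W -> V}),
    injective i /\ forall v, S v <-> exists w, i w = v.
Proof.
move=> S0 SL.
have Scl : submod_closed (fun v => `[< S v >]).
  split; first exact/asboolP.
  by move=> a u v /asboolP Su /asboolP Sv; apply/asboolP/SL.
pose W : lmodType R := submodule_type (Submodule Scl).
have [i iE] : exists i : {linear W -> V}, i =1 val.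
  by apply: linear_exists => a x y; rewrite -[RHS]/(val (a *: x + y)).
exists W, i; split; first by move=> x y; rewrite !iE => /val_inj.
move=> v; split=> [Sv|[w <-]]; last by rewrite iE; have /asboolP := valP w.
have vS : v \in submodule_pred (Submodule Scl) by apply/asboolP.
by exists (exist _ v vS); rewrite iE.
Qed.

(** * Tensor products *)

Section TensorTheory.
Context (R : pzRingType) (E : lmodType R^c).
Implicit Types (M N P : lmodType R).

HB.instance Definition _ M N (f : {linear M -> N}) :=
  GRing.isZmodMorphism.Build _ _ (tensor_map E f) (@tensor_mapB R E M N f).

Lemma tensDl M (e e' : E) (m : M) : tens (e + e') m = tens e m + tens e' m.
Proof. by have [h _ _] := @tens_balanced R E M. Qed.

Lemma tensDr M (e : E) (m m' : M) : tens e (m + m') = tens e m + tens e m'.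
Proof. by have [_ h _] := @tens_balanced R E M. Qed.

Lemma tensZ M (e : E) (r : R) (m : M) : tens ((r : R^c) *: e) m = tens e (r *: m).
Proof. by have [_ _ h] := @tens_balanced R E M. Qed.

Lemma tens0l M (m : M) : tens (0 : E) m = 0.
Proof. by apply: (@addrI _ (tens 0 m)); rewrite -tensDl !addr0. Qed.

Lemma tens0r M (e : E) : tens e (0 : M) = 0.
Proof. by apply: (@addrI _ (tens e 0)); rewrite -tensDr !addr0. Qed.

Lemma tensNl M (e : E) (m : M) : tens (- e) m = - tens e m.
Proof. by apply/eqP; rewrite -addr_eq0 -tensDl addNr tens0l. Qed.

Lemma tens_suml M I (r : seq I) (F : I -> E) (m : M) :
  tens (\sum_(i <- r) F i) m = \sum_(i <- r) tens (F i) m.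
Proof. exact: (big_morph (fun e => tens e m) (fun _ _ => tensDl _ _ _) (tens0l m)). Qed.

Lemma tens_sumr M I (r : seq I) (F : I -> M) (e : E) :
  tens e (\sum_(i <- r) F i) = \sum_(i <- r) tens e (F i).
Proof. exact: (big_morph (tens e) (tensDr e) (tens0r M e)). Qed.

Lemma tensor_sum M (t : tensor E M) :
  exists s : seq (E * M), t = \sum_(p <- s) tens p.1 p.2.
Proof.
elim/tensor_ind: t => [|t t' [s ->] [s' ->]|e m].
- by exists [::]; rewrite big_nil.
- exists (s ++ [seq (- p.1, p.2) | p <- s']).
  rewrite big_cat big_map/= -sumrN; congr (_ + _).
  by apply: eq_bigr => p _; rewrite tensNl.
- by exists [:: (e, m)]; rewrite big_seq1.
Qed.

Lemma tensor_map_comp M N P (f : {linear M -> N}) (g : {linear N -> P})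
    (h : {linear M -> P}) : (forall x, h x = g (f x)) ->
  forall t, tensor_map E h t = tensor_map E g (tensor_map E f t).
Proof.
move=> hE; elim/tensor_ind => [|t t' IH IH'|e m]; first by rewrite !raddf0.
  by rewrite !tensor_mapB IH IH'.
by rewrite !tensor_map_tens hE.
Qed.

Lemma tensor_map_id M (f : {linear M -> M}) : (forall x, f x = x) ->
  forall t, tensor_map E f t = t.
Proof.
move=> fE; elim/tensor_ind => [|t t' IH IH'|e m]; first by rewrite raddf0.
  by rewrite tensor_mapB IH IH'.
by rewrite tensor_map_tens fE.
Qed.

Lemma tensor_map0 M N (f : {linear M -> N}) : (forall x, f x = 0) ->
  forall t, tensor_map E f t = 0.
Proof.
move=> fE; elim/tensor_ind => [|t t' IH IH'|e m]; first by rewrite raddf0.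
  by rewrite tensor_mapB IH IH' subrr.
by rewrite tensor_map_tens fE tens0r.
Qed.

Lemma tensor_mapD M N (f g h : {linear M -> N}) : (forall x, h x = f x + g x) ->
  forall t, tensor_map E h t = tensor_map E f t + tensor_map E g t.
Proof.
move=> hE; elim/tensor_ind => [|t t' IH IH'|e m]; first by rewrite !raddf0 addr0.
  by rewrite !tensor_mapB IH IH' addrACA -opprD.
by rewrite !tensor_map_tens hE tensDr.
Qed.

Lemma tensor_map_surjective M N (g : {linear M -> N}) :
  is_surjective g -> is_surjective (tensor_map E g).
Proof.
move=> gS; elim/tensor_ind => [|t t' [s <-] [s' <-]|e m].
- by exists 0; rewrite raddf0.
- by exists (s - s'); rewrite tensor_mapB.
- by have [x <-] := gS m; exists (tens e x); rewrite tensor_map_tens.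
Qed.

Lemma balanced_additive M (G : zmodType) (f : E -> M -> G) : balanced f ->
  exists F : {additive tensor E M -> G}, forall e m, F (tens e m) = f e m.
Proof.
move=> fb; have [F FE] := additive_exists (tensor_liftB fb).
by exists F => e m; rewrite FE tensor_lift_tens.
Qed.

(** A character of E (x) N killing the image of E (x) M factors through
    E (x) P, by choosing preimages along g; characters separate points from
    subgroups. *)
Lemma tensor_right_exact M N P (f : {linear M -> N}) (g : {linear N -> P}) :
  exact_pair f g -> is_surjective g ->
  forall t, tensor_map E g t = 0 -> exists s, tensor_map E f s = t.
Proof.
move=> fg gS t gt0; apply: contrapT => nt.
have [|||chi chi0 chit] := @QZ_separates _ (fun t => exists s, tensor_map E f s = t) t.
- by exists 0; rewrite raddf0.
- by move=> _ _ [x <-] [y <-]; exists (x - y); rewrite tensor_mapB.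
- by [].
have /choice[sigma sigmaP] := gS.
have chi_ker e y y' : g y = g y' -> chi (tens e y) = chi (tens e y').
  move=> gy; have /fg[x fx] : g (y - y') = 0 by rewrite linearB gy subrr.
  rewrite -[y](subrK y') tensDr raddfD -fx chi0 ?add0r//.
  by exists (tens e x); rewrite tensor_map_tens.
have [|F FE] := @balanced_additive _ _ (fun e p => chi (tens e (sigma p))).
  split=> [e e' p|e p p'|e r p].
  - by rewrite tensDl raddfD.
  - by rewrite -raddfD -tensDr; apply: chi_ker; rewrite linearD !sigmaP.
  - by rewrite tensZ; apply: chi_ker; rewrite linearZ/= !sigmaP.
have FgE s : F (tensor_map E g s) = chi s.
  elim/tensor_ind: s => [|s s' IH IH'|e y]; first by rewrite !raddf0.
    by rewrite tensor_mapB !raddfB IH IH'.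
  by rewrite tensor_map_tens FE; apply: chi_ker; rewrite sigmaP.
by move: chit; rewrite -FgE gt0 raddf0 eqxx.
Qed.

End TensorTheory.

(** * Dual bases of projective modules *)

Section DualBasis.
Context (R : pzRingType).

(** The index set of the dual basis is Q itself: every projective module is a
    retract of the free module on its elements. *)
Definition dual_basis (Q : lmodType R) (coef : Q -> Q -> R) (supp : Q -> seq Q) :=
  [/\ forall x, uniq (supp x),
      forall x b, b \notin supp x -> coef x b = 0,
      forall a x y b, coef (a *: x + y) b = a * coef x b + coef y b &
      forall x, x = \sum_(b <- supp x) coef x b *: b].

Lemma big_support (I : eqType) (G : nmodType) (s s' : seq I) (F : I -> G) :
  uniq s -> uniq s' -> (forall i, i \notin s -> F i = 0) -> {subset s <= s'} ->
  \sum_(i <- s') F i = \sum_(i <- s) F i.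
Proof.
move=> us us' F0 ss'; rewrite (bigID (mem s))/= [X in _ + X]big1 ?addr0//.
rewrite -big_filter; apply: perm_big; apply: uniq_perm => //.
  exact: filter_uniq.
move=> i; rewrite mem_filter; apply/andP/idP => [[]//|si].
by split=> //; apply: ss'.
Qed.

Lemma dual_basis_exists (Q : lmodType R) : projective_module Q ->
  exists coef supp, @dual_basis Q coef supp.
Proof.
move=> Qproj.
(* The free module on Q: functions of finite support. *)
pose fin (f : Q -> R^o) := exists s : seq Q, forall x, x \notin s -> f x = 0.
have [||W [i [iI iP]]] := @submodule_exists R (Q -> R^o) fin.
- by exists [::].
- move=> a u v [s us] [s' vs']; exists (s ++ s') => x.
  rewrite mem_cat negb_or => /andP[/us xs /vs' xs'].
  by rewrite -[LHS]/(a *: u x + v x) xs xs' scaler0 addr0.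
have /choice[supp suppP] : forall w, exists s : seq Q,
    uniq s /\ forall x, x \notin s -> i w x = 0.
  move=> w; have [s sP] : fin (i w) by apply/iP; exists w.
  by exists (undup s); split=> [|x]; rewrite ?undup_uniq ?mem_undup//; apply: sP.
pose sigma w := \sum_(b <- supp w) (i w b : R) *: b.
have sigmaE w s : uniq s -> {subset supp w <= s} ->
    sigma w = \sum_(b <- s) (i w b : R) *: b.
  move=> us ss; apply/esym/big_support => //; first by case: (suppP w).
  by move=> b bs; have [_ ->//] := suppP w; rewrite scale0r.
have [sig sigE] : exists sig : {linear W -> Q}, sig =1 sigma.
  apply: linear_exists => a x y.
  pose s := undup (supp x ++ supp y ++ supp (a *: x + y)).
  have us : uniq s by apply: undup_uniq.
  rewrite !(@sigmaE _ s)//; try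
    by move=> b bs; rewrite mem_undup !mem_cat bs ?orbT.
  rewrite scaler_sumr -big_split/=; apply: eq_bigr => b _.
  by rewrite linearP -[(a *: i x + i y) b]/(a * i x b + i y b) scalerDl scalerA.
have sigS : is_surjective sig.
  move=> x; pose d : Q -> R^o := fun y => if y == x then 1 else 0.
  have [w wd] : exists w, i w = d.
    by apply/iP; exists [:: x] => y; rewrite inE /d => /negbTE->.
  exists w; rewrite sigE (@sigmaE _ (undup (x :: supp w))) ?undup_uniq//.
    rewrite (@big_support _ _ [:: x]) ?undup_uniq// ?big_seq1 ?wd /d ?eqxx ?scale1r//.
      by move=> y; rewrite inE => /negbTE->; rewrite scale0r.
    by move=> y; rewrite inE mem_undup => /eqP->; rewrite mem_head.
  by move=> b bs; rewrite mem_undup inE bs orbT.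
have [h hP] := Qproj _ _ sig idfun sigS.
exists (fun x b => i (h x) b), (fun x => supp (h x)); split.
- by move=> x; case: (suppP (h x)).
- by move=> x b; case: (suppP (h x)) => _; apply.
- by move=> a x y b; rewrite !linearP.
- by move=> x; rewrite -[LHS]/(idfun x) -hP sigE.
Qed.

Section Theory.
Context (Q : lmodType R) (coef : Q -> Q -> R) (supp : Q -> seq Q).
Hypothesis QP : dual_basis coef supp.

Lemma dual_basis_sum (G : nmodType) (F : Q -> R -> G) s x :
  (forall b, F b 0 = 0) -> uniq s -> {subset supp x <= s} ->
  \sum_(b <- supp x) F b (coef x b) = \sum_(b <- s) F b (coef x b).
Proof.
have [us c0 _ _] := QP; move=> F0 ss sub; apply/esym/big_support => // b bs.
by rewrite c0.
Qed.

(** The supports of x, y and x - y differ, so the sums are compared over a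
    common list. *)
Lemma dual_basis_additive (G : zmodType) (F : Q -> R -> G) :
  (forall b, {morph F b : r r' / r - r'}) ->
  {morph (fun x => \sum_(b <- supp x) F b (coef x b)) : x y / x - y}.
Proof.
have [us c0 cL _] := QP; move=> FB x y /=.
have F0 b : F b 0 = 0 by have := FB b 0 0; rewrite !subrr.
pose s := undup (supp x ++ supp y ++ supp (x - y)).
have us' : uniq s by apply: undup_uniq.
rewrite !(@dual_basis_sum _ _ s)//; try
    by move=> b bs; rewrite mem_undup !mem_cat bs ?orbT.
rewrite -sumrB; apply: eq_bigr => b _; rewrite -FB.
by rewrite addrC -scaleN1r cL mulN1r addrC.
Qed.

Lemma coef_linear (X : lmodType R) (b : Q) (x : X) :
  exists f : {linear Q -> X}, forall y, f y = coef y b *: x.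
Proof.
have [_ _ cL _] := QP; have [|f fE] := @linear_exists _ Q X (fun y => coef y b *: x).
  by move=> a y y'; rewrite cL scalerDl scalerA.
by exists f.
Qed.

End Theory.
End DualBasis.

(** * Character modules *)

(** The right module of J-indexed families of characters of X, that is the
    product over J of the modules Hom (X, Q/Z). *)
Section Characters.
Context (R : pzRingType) (J : Type) (X : lmodType R).

Definition char_pred : {pred J -> X -> QZ} :=
  fun f => `[< forall j, {morph f j : x y / x - y} >].

Lemma char_pred_closed : zmod_closed char_pred.
Proof.
split=> [|f g /asboolP fB /asboolP gB]; apply/asboolP => j x y.
  by rewrite -[LHS]/(0 : QZ) -[RHS]/(0 - 0 : QZ) subrr.
rewrite -[LHS]/(f j (x - y) - g j (x - y)) fB gB.
by rewrite -[RHS]/(f j x - g j x - (f j y - g j y)) subrACA.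
Qed.

HB.instance Definition _ :=
  GRing.isZmodClosed.Build (J -> X -> QZ) char_pred char_pred_closed.

Definition characters := {f : J -> X -> QZ | f \in char_pred}.

HB.instance Definition _ := [isSub of characters for sval].
HB.instance Definition _ := [Choice of characters by <:].
HB.instance Definition _ := [SubChoice_isSubZmodule of characters by <:].

Lemma charB (f : characters) j : {morph val f j : x y / x - y}.
Proof. by have /asboolP := valP f. Qed.

Lemma char_subproof (r : R^c) (f : characters) :
  (fun j x => val f j ((r : R) *: x)) \in char_pred.
Proof. by apply/asboolP => j x y; rewrite scalerBr charB. Qed.

Definition char_scale (r : R^c) (f : characters) : characters :=
  @exist _ (fun f => f \in char_pred) _ (char_subproof r f).

Lemma char_scaleA (r s : R^c) f : char_scale r (char_scale s f) = char_scale (r * s) f.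
Proof. by apply: val_inj; apply/funext => j; apply/funext => x /=; rewrite scalerA. Qed.

Lemma char_scale1 : left_id 1 char_scale.
Proof. by move=> f; apply: val_inj; apply/funext => j; apply/funext => x /=; rewrite scale1r. Qed.

Lemma char_scaleDr : right_distributive char_scale +%R.
Proof. by move=> r f g; apply: val_inj; apply/funext => j; apply/funext => x. Qed.

Lemma charD (f : characters) j : {morph val f j : x y / x + y}.
Proof.
have f0 : val f j 0 = 0 by have := charB f j 0 0; rewrite !subrr.
by move=> x y; rewrite -[y in LHS]opprK charB -[- y]sub0r charB f0 sub0r opprK.
Qed.

Lemma char_scaleDl f : {morph char_scale^~ f : r s / r + s}.
Proof.
move=> r s; apply: val_inj; apply/funext => j; apply/funext => x /=.
by rewrite scalerDl charD.
Qed.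

HB.instance Definition _ := GRing.Zmodule_isLmodule.Build R^c characters
  char_scaleA char_scale1 char_scaleDr char_scaleDl.

Lemma char_scaleE (r : R) (f : characters) j x :
  val ((r : R^c) *: f) j x = val f j (r *: x).
Proof. by []. Qed.

Lemma char_sumE I (s : seq I) (F : I -> characters) j x :
  val (\sum_(i <- s) F i) j x = \sum_(i <- s) val (F i) j x.
Proof.
elim: s => [|i s IHs]; first by rewrite !big_nil.
by rewrite !big_cons -IHs.
Qed.

(** For each b in the dual basis of X, extend a |-> f(a)(b) from A to B by
    injectivity of Q/Z, and reassemble the extensions with the coordinates of
    x. *)
Lemma characters_injective : projective_module X ->
  injective_module (characters : lmodType R^c).
Proof.
move=> /dual_basis_exists[coef [supp QP]] A B i f iI.
have fjB j b : {morph (fun a => val (f a) j b) : a a' / a - a'}.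
  by move=> a a'; rewrite linearB.
have /choice[g gP] : forall p : J * X, exists g : {additive B -> QZ},
    forall a, g (i a) = val (f a) p.1 p.2.
  move=> [j b]; have [fj fjE] := additive_exists (fjB j b).
  by have [g gP] := QZ_injective fj iI; exists g => a; rewrite gP fjE.
pose h0 (y : B) j x := \sum_(b <- supp x) g (j, b) ((coef x b : R^c) *: y).
have h0_char y : h0 y \in char_pred.
  apply/asboolP => j; apply: (dual_basis_additive QP (F := fun b r => g (j, b) ((r : R^c) *: y))).
  by move=> b r r' /=; rewrite scalerBl raddfB.
pose h y : characters := @exist _ (fun f => f \in char_pred) _ (h0_char y).
have [_ c0 cL xE] := QP.
have [H HE] : exists H : {linear B -> characters}, H =1 h.
  apply: linear_exists => r y y'; apply: val_inj; apply/funext => j; apply/funext => x.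
  rewrite -[RHS]/(h0 y j ((r : R) *: x) + h0 y' j x) /= /h0.
  pose s := undup (supp x ++ supp ((r : R) *: x)).
  have sums z w : {subset supp w <= s} ->
      \sum_(b <- supp w) g (j, b) ((coef w b : R^c) *: z) =
      \sum_(b <- s) g (j, b) ((coef w b : R^c) *: z).
    move=> ws; apply: (dual_basis_sum QP (F := fun b c => g (j, b) ((c : R^c) *: z))) => //.
      by move=> b; rewrite -[0 : R]/(0 : R^c) scale0r raddf0.
    exact: undup_uniq.
  rewrite !sums; try by move=> b bs; rewrite mem_undup mem_cat bs ?orbT.
  rewrite -big_split/=; apply: eq_bigr => b _.
  have -> : coef ((r : R) *: x) b = (r : R) * coef x b.
    have coef0 : coef 0 b = 0.
      by have := cL 1 0 0 b; rewrite scaler0 addr0 mul1r => /esym/eqP; rewrite -subr_eq0 addrK => /eqP.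
    by rewrite -[_ *: x]addr0 cL coef0 addr0.
  rewrite scalerDr raddfD scalerA.
  by congr (g (j, b) _ + _).
exists H => a; rewrite HE; apply: val_inj; apply/funext => j; apply/funext => x.
rewrite /= /h0 [in RHS](xE x) (big_morph (val (f a) j) (charD (f a) j) (id1 := 0)); last first.
  by have := charB (f a) j 0 0; rewrite !subrr.
apply: eq_bigr => b _.
by rewrite -linearZ/= gP linearZ.
Qed.

(** Expanding the z k in a dual basis of P, the coefficient of a basis element b
    is the character x |-> sum_k chi_k (b*(z k) x), and b*(-) x is one of the maps
    psi of the hypothesis. *)
Lemma char_tensor_eq0 (P : lmodType R) n (chi : 'I_n -> characters) (z : 'I_n -> P) :
  projective_module P ->
  (forall j (psi : {linear P -> X}), \sum_k val (chi k) j (psi (z k)) = 0) ->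
  \sum_k tens (chi k) (z k) = 0 :> tensor (characters : lmodType R^c) P.
Proof.
move=> /dual_basis_exists[coef [supp PP]] h; have [us c0 cL xE] := PP.
pose s := undup (flatten [seq supp (z k) | k <- enum 'I_n]).
have zE k : z k = \sum_(b <- s) coef (z k) b *: b.
  rewrite [LHS]xE; apply: (dual_basis_sum PP (F := fun b r => r *: b)) => [b||b bk].
  - exact: scale0r.
  - exact: undup_uniq.
  - rewrite mem_undup; apply/flattenP; exists (supp (z k)) => //.
    by apply: map_f; rewrite mem_enum.
under eq_bigr => k _ do (rewrite [z k]zE tens_sumr).
rewrite exchange_big/= big1// => b _.
under eq_bigr => k _ do rewrite -tensZ.
rewrite -tens_suml (_ : \sum_k _ = 0) ?tens0l//.
apply: val_inj; apply/funext => j; apply/funext => x; rewrite char_sumE.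
have [psi psiE] := coef_linear PP b x.
by rewrite -[RHS](h j psi); apply: eq_bigr => k _; rewrite char_scaleE psiE.
Qed.

End Characters.

(** * Tensor-exact complexes of projectives are Hom-exact *)

Section TensorExactHomExact.
Context (R : pzRingType) (C : zseq R) (X : lmodType R).
Hypothesis Cproj : complex_of_projectives C.
Hypothesis Xproj : projective_module X.
Hypothesis dd : forall i x, diff C i (diff C (i + 1) x) = 0.
Hypothesis Ctens : forall E : lmodType R^c, injective_module E -> tensor_exact E C.

(** The counterexamples phi_Y for all finite Y are refuted simultaneously by the
    tensor t with coefficients in the product over Y of the character modules;
    the product is what turns exactness for each injective module into a bound Y
    independent of phi. *)
Lemma finite_approximation i n (a : 'I_n -> C (i + 1)) :
  exists Y : seq (C (i + 1 + 1)), forall phi : {linear C (i + 1) -> X},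
    (forall y, y \in Y -> phi (diff C (i + 1) y) = 0) ->
    exists psi : {linear C i -> X}, forall k, psi (diff C i (a k)) = phi (a k).
Proof.
apply: contrapT => noY.
have /choice[phi phiP] : forall Y : seq (C (i + 1 + 1)),
    exists phi : {linear C (i + 1) -> X},
    (forall y, y \in Y -> phi (diff C (i + 1) y) = 0) /\
    ~ exists psi : {linear C i -> X}, forall k, psi (diff C i (a k)) = phi (a k).
  move=> Y; apply: contrapT => nophi; apply: noY; exists Y => phi phiY.
  by apply: contrapT => nopsi; apply: nophi; exists phi.
(* The tuples (psi (d a)), a subgroup to be separated from (phi_Y a). *)
pose S (v : {ffun 'I_n -> X}) :=
  exists psi : {linear C i -> X}, forall k, v k = psi (diff C i (a k)).
have /choice[chi chiP] : forall Y, exists chi : {additive {ffun 'I_n -> X} -> QZ},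
    (forall v, S v -> chi v = 0) /\ chi [ffun k => phi Y (a k)] != 0.
  move=> Y; have [|||chi] := @QZ_separates _ S [ffun k => phi Y (a k)].
  - by exists \0%R => k; rewrite ffunE.
  - move=> u v [psi psiE] [psi' psiE'].
    by exists (psi \- psi')%R => k; rewrite !ffunE/= psiE psiE'.
  - have [_ nopsi] := phiP Y; move=> [psi psiE]; apply: nopsi; exists psi => k.
    by rewrite -psiE ffunE.
  by exists chi.
pose J := seq (C (i + 1 + 1)).
pose delta k (x : X) : {ffun 'I_n -> X} := [ffun l => if l == k then x else 0].
have deltaB k : {morph delta k : x y / x - y}.
  by move=> x y; apply/ffunP => l; rewrite !ffunE; case: eqP; rewrite ?subr0.
have sum_delta (v : {ffun 'I_n -> X}) : \sum_k delta k (v k) = v.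
  apply/ffunP => l; rewrite sum_ffunE (bigD1 l)//= ffunE eqxx big1 ?addr0//.
  by move=> k kl; rewrite ffunE eq_sym (negbTE kl).
have comp_char k : (fun (Y : J) x => chi Y (delta k x)) \in @char_pred R J X.
  by apply/asboolP => Y x y; rewrite deltaB raddfB.
pose c k : characters J X := @exist _ (fun f => f \in @char_pred R J X) _ (comp_char k).
pose E : lmodType R^c := characters J X.
have Einj : injective_module E by apply: characters_injective.
pose t : tensor E (C (i + 1)) := \sum_k tens (c k : E) (a k).
have dt0 : tensor_map E (diff C i) t = 0.
  rewrite /t raddf_sum; under eq_bigr => k _ do rewrite /= tensor_map_tens.
  apply: char_tensor_eq0 => // Y psi; rewrite /= -raddf_sum.
  rewrite (_ : \sum_k _ = [ffun k => psi (diff C i (a k))]).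
    by apply: (chiP Y).1; exists psi => k; rewrite ffunE.
  by rewrite -[RHS]sum_delta; apply: eq_bigr => k _; rewrite ffunE.
have [u ut] := (Ctens Einj t).1 dt0.
have [s us] := tensor_sum u.
(* Evaluate t at the index Y0 formed by the finitely many elements in u. *)
pose Y0 : J := map snd s.
have [|F FE] := @balanced_additive R E (C (i + 1)) _ (fun e m => val e Y0 (phi Y0 m)).
  split=> [e e' m|e m m'|e r m].
  - by [].
  - by rewrite linearD charD.
  - by rewrite linearZ.
have /eqP[] := (chiP Y0).2.
transitivity (F t).
  rewrite /t raddf_sum; under [RHS]eq_bigr => k _ do rewrite /= FE.
  rewrite /= -raddf_sum -[in LHS](sum_delta [ffun k => phi Y0 (a k)]).
  by congr (chi Y0 _); apply: eq_bigr => k _; rewrite ffunE.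
rewrite -ut us !raddf_sum big_seq big1// => p ps /=.
rewrite tensor_map_tens FE (phiP Y0).1 ?map_f//.
by have := charB p.1 Y0 0 0; rewrite !subrr.
Qed.

Definition cells := {i : int & C i}.

Definition cell i (x : C i) : cells := existT _ i x.

(** The differentials have sources of the form C (i + 1); [down] is the
    differential out of C j when j is only provably a successor. *)
Definition down (i j : int) (e : j = i + 1) : {linear C j -> C i} :=
  eq_rect_r (fun j => {linear C j -> C i}) (diff C i) e.

Lemma pred_succ (j : int) : j = j - 1 + 1. Proof. by rewrite subrK. Qed.

Definition cell_diff (p : cells) : cells :=
  cell (down (pred_succ (tag p)) (tagged p)).

Lemma cell_down i i' j (e : j = i + 1) (e' : j = i' + 1) (x : C j) :
  cell (down e x) = cell (down e' x).
Proof.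
have ii' : i = i' by apply: (@addIr _ 1); rewrite -e.
by case: _ / ii' e' => e'; rewrite (eq_irrelevance e' e).
Qed.

Lemma cell_diffE i (x : C (i + 1)) :
  cell_diff (cell x) = cell (diff C i x).
Proof. exact: (cell_down _ (erefl _)). Qed.

Lemma cell_succ (p : cells) : exists x : C (tag p - 1 + 1), p = cell x.
Proof.
by exists (etagged (pred_succ (tag p))); apply/esym/etaggedK.
Qed.

Lemma cell_at (p : cells) i : tag p = i -> exists x : C i, p = cell x.
Proof. by move=> e; exists (etagged e); apply/esym/etaggedK. Qed.

Section Cochains.
Context (coef : forall i, C i -> C i -> R) (supp : forall i, C i -> seq (C i)).
Hypothesis dualP : forall i, dual_basis (@coef i) (@supp i).
Implicit Types phi psi : cells -> X.

(** The projection of all functions on the elements of C onto the families of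
    linear maps C i -> X: the linear map with the values of phi on the dual
    basis. *)
Definition linearize phi : cells -> X := fun p =>
  \sum_(b <- supp (tagged p)) coef (tagged p) b *: phi (cell b).

Definition coboundary phi : cells -> X := fun p => linearize phi (cell_diff p).

Definition cell_support (p : cells) : seq cells :=
  [seq cell b | b <- supp (tagged p)].

Lemma linearize_linear phi i :
  exists f : {linear C i -> X}, forall x, linearize phi (cell x) = f x.
Proof.
have [us c0 cL xE] := dualP i.
have [|f fE] := @linear_exists _ (C i) X (fun x => linearize phi (cell x)).
  move=> a x y; pose s := undup (supp x ++ supp y ++ supp (a *: x + y)).
  have sums z : {subset supp z <= s} -> linearize phi (cell z) =
      \sum_(b <- s) coef z b *: phi (cell b).
    move=> zs; apply: (dual_basis_sum (dualP i) (F := fun b r => r *: phi (cell b))) => //.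
      by move=> b; rewrite scale0r.
    exact: undup_uniq.
  rewrite !sums; try by move=> b bs; rewrite mem_undup !mem_cat bs ?orbT.
  rewrite scaler_sumr -big_split/=; apply: eq_bigr => b _.
  by rewrite cL scalerDl scalerA.
by exists f.
Qed.

Lemma linearize_id phi :
  (forall i, exists f : {linear C i -> X}, forall x, phi (cell x) = f x) ->
  linearize phi = phi.
Proof.
move=> phiL; apply/funext => -[i x]; have [f fE] := phiL i.
have [_ _ _ xE] := dualP i.
rewrite [RHS]fE {2}[x]xE linear_sum; apply: eq_bigr => b _.
by rewrite linearZ/= -fE.
Qed.

Lemma coboundary_diff phi i (x : C (i + 1)) :
  coboundary phi (cell x) = linearize phi (cell (diff C i x)).
Proof. by rewrite /coboundary cell_diffE. Qed.

Lemma linearizeK phi : linearize (linearize phi) = linearize phi.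
Proof. by apply: linearize_id; apply: linearize_linear. Qed.

Lemma linearize_coboundary phi : linearize (coboundary phi) = coboundary phi.
Proof.
apply: linearize_id => i; have [f fE] := linearize_linear phi (i - 1).
have [|g gE] := @linear_exists _ (C i) X (fun x => f (down (pred_succ i) x)).
  by move=> a x y; rewrite !linearP.
by exists g => x; rewrite gE -fE.
Qed.

Lemma coboundary_coboundary phi : coboundary (coboundary phi) = 0.
Proof.
apply/funext => p; rewrite {1}/coboundary linearize_coboundary /coboundary.
have [x ->] : exists x : C (tag p - 1 - 1 + 1 + 1), p = cell x.
  by apply: cell_at; rewrite !subrK.
rewrite !cell_diffE dd.
by have [f ->] := linearize_linear phi (tag p - 1 - 1); rewrite linear0.
Qed.

Lemma linearize_sub phi psi : linearize (phi - psi) = linearize phi - linearize psi.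
Proof.
apply/funext => p; rewrite -[RHS]/(linearize phi p - linearize psi p) -sumrB.
by apply: eq_bigr => b _; rewrite -scalerBr.
Qed.

Lemma coboundary_sub phi psi : coboundary (phi - psi) = coboundary phi - coboundary psi.
Proof. by rewrite /coboundary linearize_sub. Qed.

Lemma linearize_local p phi psi :
  {in cell_support p, phi =1 psi} -> linearize phi p = linearize psi p.
Proof.
move=> h; rewrite /linearize big_seq [RHS]big_seq; apply: eq_bigr => b bp.
by rewrite h//; apply: map_f.
Qed.

(** [finite_approximation] in each of the finitely many degrees in which A has
    elements. *)
Lemma coboundary_solvable : solvable_between linearize coboundary set0 [set: cells].
Proof.
move=> A _.
(* The elements of A of degree i + 1, the others being replaced by 0. *)
pose n := size A; pose a i (k : 'I_n) : C (i + 1) :=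
  untag 0 (fun x : C (i + 1) => x) (tnth (in_tuple A) k).
have Yex i := finite_approximation (a i).
pose Y i := sval (cid (Yex i)).
exists (flatten [seq [seq cell y | y <- Y (tag p - 1)] | p <- A]) => // phi _ ephi dphi.
have {}ephi : linearize phi = phi by apply/funext => p; apply: ephi.
have psiex i : exists psi : {linear C i -> X}, (exists2 p, p \in A & tag p - 1 = i) ->
    forall k, psi (diff C i (a i k)) = phi (cell (a i k)).
  have [[p pA <-]|noA] := pselect (exists2 p, p \in A & tag p - 1 = i); last first.
    by exists \0%R.
  have [f fE] := linearize_linear phi (tag p - 1 + 1).
  have [|psi psiP] := svalP (cid (Yex (tag p - 1))) f.
    move=> y Yy; rewrite -fE -coboundary_diff; apply: dphi.
    apply/flattenP; exists [seq cell y | y <- Y (tag p - 1)]; last exact: map_f.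
    by apply/mapP; exists p.
  by exists psi => _ k; rewrite psiP -fE ephi.
pose psi i := sval (cid (psiex i)).
exists (fun p => psi (tag p) (tagged p)) => // p pA.
have [x px] := cell_succ p.
rewrite px coboundary_diff linearize_id; last by move=> i; exists (psi i).
have [k kp] : exists k, tnth (in_tuple A) k = p.
  by move: pA => /(nthP p)[k kA <-]; exists (Ordinal kA); rewrite (tnth_nth p).
have xa : x = a (tag p - 1) k.
  by rewrite /a kp untagE ?subrK// => e; apply: eq_from_Tagged; rewrite etaggedK.
rewrite /= xa; apply: (svalP (cid (psiex _))).
by exists p.
Qed.

End Cochains.

Theorem tensor_exact_hom_exact : hom_exact C X.
Proof.
pose db (i : int) := cid (dual_basis_exists (@Cproj i)).
pose coef i := projT1 (db i).
have /= dbP i := projT2 (db i).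
pose supp i := projT1 (cid (dbP i)).
have dualP i : dual_basis (coef i) (supp i) by exact: projT2 (cid (dbP i)).
move=> i phi; split=> [phid|[psi psiP] x]; last by rewrite -psiP dd linear0.
pose Phi (p : cells) : X := untag 0 phi p.
have PhiE x : Phi (cell x) = phi x.
  exact: (@untagE _ _ _ 0 (i + 1) phi (cell x) erefl).
have Phi0 p : tag p != i + 1 -> Phi p = 0 by exact: untag_dflt.
have Philin : linearize coef supp Phi = Phi.
  apply: linearize_id => // j; have [->|ne] := eqVneq j (i + 1); first by exists phi.
  by exists \0%R => x; rewrite Phi0.
pose N p := cell_support supp p ++ cell_support supp (cell_diff p).
have linN p f g : {in N p, f =1 g} -> linearize coef supp f p = linearize coef supp g p.
  by move=> fg; apply: linearize_local => b bp; apply: fg; rewrite mem_cat bp.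
have cobN p f g : {in N p, f =1 g} -> coboundary coef supp f p = coboundary coef supp g p.
  by move=> fg; apply: linearize_local => b bp; apply: fg; rewrite mem_cat bp orbT.
have [||psi psiE] := local_cocycle_coboundary (linearize_sub _ _) (coboundary_sub _ _)
    linN cobN (linearizeK dualP) _ (linearize_coboundary dualP)
    (coboundary_coboundary dualP) (coboundary_solvable dualP) Philin.
- by move=> f; rewrite /coboundary linearizeK.
- apply/funext => p; have [e|ne] := eqVneq (tag p) (i + 1 + 1).
    by have [y ->] := cell_at e; rewrite coboundary_diff Philin PhiE phid.
  have [x ->] := cell_succ p; rewrite coboundary_diff Philin Phi0//=.
  by apply: contraNneq ne => <-; rewrite subrK.
have [f fE] := linearize_linear dualP psi i.
by exists f => x; rewrite -fE -coboundary_diff psiE PhiE.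
Qed.

End TensorExactHomExact.

(** * Linear maps, kernels and pullbacks *)

Section LinearTools.
Context (R : pzRingType).
Implicit Types (A B K P Q W : lmodType R).

Lemma linear_injective A B (f : {linear A -> B}) :
  (forall x, f x = 0 -> x = 0) -> injective f.
Proof.
by move=> f0 x y fxy; apply/eqP; rewrite -subr_eq0; apply/eqP/f0; rewrite linearB fxy subrr.
Qed.

Lemma lift_along_mono A P Q (f : {linear A -> P}) (g : {linear Q -> P}) :
  injective f -> (forall x, exists a, f a = g x) ->
  exists h : {linear Q -> A}, forall x, f (h x) = g x.
Proof.
move=> fI /choice[h hP]; have [|k kE] := @linear_exists _ _ _ h.
  by move=> a x y; apply: fI; rewrite linearP !hP linearP.
by exists k => x; rewrite kE.
Qed.

Lemma factor_through_epi P B Q (p : {linear P -> B}) (g : {linear P -> Q}) :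
  is_surjective p -> (forall x, p x = 0 -> g x = 0) ->
  exists h : {linear B -> Q}, forall x, h (p x) = g x.
Proof.
move=> /choice[s sP] pg.
have gE x y : p x = p y -> g x = g y.
  by move=> pxy; apply/eqP; rewrite -subr_eq0 -linearB pg// linearB pxy subrr.
have [|k kE] := @linear_exists _ _ _ (g \o s).
  by move=> a x y; rewrite /= -linearP; apply: gE; rewrite linearP !sP.
by exists k => x; rewrite kE/=; apply: gE; rewrite sP.
Qed.

Lemma pair_exists A P Q (f : {linear A -> P}) (g : {linear A -> Q}) :
  exists h : {linear A -> (P * Q)%type}, forall x, h x = (f x, g x).
Proof.
have [|k kE] := @linear_exists _ A (P * Q)%type (fun x => (f x, g x)).
  by move=> a x y; rewrite !linearP.
by exists k.
Qed.

Lemma copair_exists A P Q (f : {linear P -> A}) (g : {linear Q -> A}) :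
  exists h : {linear (P * Q)%type -> A}, forall x, h x = f x.1 + g x.2.
Proof.
have [|k kE] := @linear_exists _ (P * Q)%type A (fun x => f x.1 + g x.2).
  by move=> a x y /=; rewrite !linearP scalerDr addrACA.
by exists k.
Qed.

Lemma projective_sum P Q :
  projective_module P -> projective_module Q -> projective_module (P * Q)%type.
Proof.
move=> Pp Qp A B g f gS.
have [i iE] := pair_exists (idfun : {linear P -> P}) (\0 : {linear P -> Q}).
have [j jE] := pair_exists (\0 : {linear Q -> P}) (idfun : {linear Q -> Q}).
have [u uE] := Pp _ _ g (f \o i) gS.
have [v vE] := Qp _ _ g (f \o j) gS.
have [h hE] := copair_exists u v.
exists h => -[x y]; rewrite hE linearD uE vE/= iE jE -linearD/=.
by congr (f _); rewrite -[LHS]/(x + 0, 0 + y) addr0 add0r.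
Qed.

Definition is_pullback A P B W (f : A -> B) (c : P -> B)
    (i : W -> (A * P)%type) :=
  injective i /\ forall x y, f x = c y <-> exists w, i w = (x, y).

Lemma pullback_exists A P B (f : {linear A -> B}) (c : {linear P -> B}) :
  exists W (i : {linear W -> (A * P)%type}), is_pullback f c i.
Proof.
have [||W [i [iI iP]]] := @submodule_exists R (A * P)%type (fun x => f x.1 = c x.2).
- by rewrite /= !linear0.
- by move=> a u v /= fu fv; rewrite !linearP fu fv.
by exists W, i; split=> // x y; rewrite -iP.
Qed.

Lemma kernel_exists A B (f : {linear A -> B}) :
  exists K (i : {linear K -> A}), injective i /\ exact_pair i f.
Proof.
have [||W [i [iI iP]]] := @submodule_exists R A (fun x => f x = 0).
- exact: linear0.
- by move=> a u v fu fv; rewrite linearP fu fv scaler0 addr0.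
by exists W, i.
Qed.

End LinearTools.

(** * Syzygies and complexes *)

Section Syzygies.
Context (R : pzRingType).
Implicit Types (A B K M N P Q G W : lmodType R) (C : zseq R) (i : int).

(** The exactness conditions on complexes used here concern the inclusions of the
    syzygies; a [mono_kind] is such a condition. *)
Definition mono_kind := forall A P, {linear A -> P} -> Prop.

Definition tensor_mono : mono_kind := fun A P f =>
  forall E : lmodType R^c, injective_module E -> injective (tensor_map E f).

(** Exactness of A -> P -> B under Hom(-, Q) for all projective Q. *)
Definition extending : mono_kind := fun A P f =>
  forall Q, projective_module Q -> forall phi : {linear A -> Q},
    exists psi : {linear P -> Q}, forall x, psi (f x) = phi x.

Definition first_syzygy (T : mono_kind) A B :=
  exists P (f : {linear A -> P}) (g : {linear P -> B}),
    [/\ projective_module P, injective f, exact_pair f g, is_surjective g & T A P f].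

Lemma tensor_injective E A P (f : {linear A -> P}) :
  (forall t, tensor_map E f t = 0 -> t = 0) -> injective (tensor_map E f).
Proof.
move=> f0 x y fxy; apply/eqP; rewrite -subr_eq0; apply/eqP/f0.
by rewrite tensor_mapB fxy subrr.
Qed.

Section FromComplex.
Context (C : zseq R).
Hypothesis Cexact : exact_complex C.

Lemma exact_complex_diff i x : diff C i (diff C (i + 1) x) = 0.
Proof. by apply/(@Cexact i); exists x. Qed.

Lemma syzygy_cover i K (k : {linear K -> C (i + 1)}) :
  injective k -> exact_pair k (diff C i) ->
  exists g : {linear C (i + 1 + 1) -> K},
    is_surjective g /\ forall x, k (g x) = diff C (i + 1) x.
Proof.
move=> kI ke; have [|g gE] := @lift_along_mono R K _ _ k (diff C (i + 1)) kI.
  by move=> x; apply/ke; apply: exact_complex_diff.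
exists g; split=> // y.
have /(@Cexact i)[x xy] : diff C i (k y) = 0 by apply/ke; exists y.
by exists x; apply: kI; rewrite gE.
Qed.

(** An element of E (x) K lifts to E (x) C (i + 2); if it dies in E (x) C (i + 1),
    its lift comes from E (x) C (i + 3), hence dies in E (x) K. *)
Lemma syzygy_tensor_mono :
  (forall E : lmodType R^c, injective_module E -> tensor_exact E C) ->
  forall i K (k : {linear K -> C (i + 1)}),
    injective k -> exact_pair k (diff C i) -> tensor_mono k.
Proof.
move=> Ct i K k kI ke E Einj; have [g [gS gE]] := syzygy_cover kI ke.
apply: tensor_injective => t kt0.
have [s st] := tensor_map_surjective gS t.
have /(Ct E Einj)[r rs] : tensor_map E (diff C (i + 1)) s = 0.
  by rewrite (tensor_map_comp (fun x => esym (gE x))) st.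
rewrite -st -rs -(tensor_map_comp (h := (g \o diff C (i + 1 + 1)))) ?tensor_map0// => x.
by apply: kI; rewrite gE linear0 exact_complex_diff.
Qed.

(** A map out of K is a cocycle on C (i + 2), the coboundary of a map out of
    C (i + 1). *)
Lemma syzygy_extending :
  (forall Q, projective_module Q -> hom_exact C Q) ->
  forall i K (k : {linear K -> C (i + 1)}),
    injective k -> exact_pair k (diff C i) -> extending k.
Proof.
move=> Ch i K k kI ke Q Qp phi; have [g [gS gE]] := syzygy_cover kI ke.
have [|psi psiE] := (Ch Q Qp (i + 1) (phi \o g)).1.
  move=> x /=; rewrite (_ : g _ = 0) ?linear0//.
  by apply: kI; rewrite gE linear0 exact_complex_diff.
by exists psi => y; have [x <-] := gS y; rewrite gE psiE.
Qed.

Context (T : mono_kind).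
Hypothesis Cproj : complex_of_projectives C.
Hypothesis CT : forall i K (k : {linear K -> C (i + 1)}),
    injective k -> exact_pair k (diff C i) -> T k.

Lemma syzygy_left M : syzygy C M -> exists2 A, syzygy C A & first_syzygy T A M.
Proof.
move=> [i [k [kI ke]]]; have [g [gS gE]] := syzygy_cover kI ke.
have [K [l [lI le]]] := kernel_exists (diff C (i + 1)).
exists K; first by exists (i + 1), l.
exists (C (i + 1 + 1)), l, g; split=> //; last exact: CT.
move=> y; rewrite -le -gE; split=> [->|/eqP]; first by rewrite linear0.
by move=> /eqP kgy; apply: kI; rewrite kgy linear0.
Qed.

Lemma syzygy_right M : syzygy C M -> exists2 B, syzygy C B & first_syzygy T M B.
Proof.
move=> [i [k [kI ke]]].
have [j ij] : exists j, i = j + 1 by exists (i - 1); rewrite subrK.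
(* The next syzygy sits in C i, which has to be presented as C (j + 1). *)
case: _ / (esym ij) k kI ke => k kI ke.
have [K [l [lI le]]] := kernel_exists (diff C j).
have [g [gS gE]] := syzygy_cover lI le.
exists K; first by exists j, l.
exists (C (j + 1 + 1)), k, g; split=> //; last exact: CT.
move=> y; rewrite -ke -gE; split=> [->|lgy]; first by rewrite linear0.
by apply: lI; rewrite lgy linear0.
Qed.

End FromComplex.

(** Left and right continuations may live in different classes, which is used
    when the class that can be continued to the right is not known to be stable
    to the left. *)
Lemma bi_infinite_splice (T : mono_kind) (Xl Xr : lmodType R -> Prop) M :
  Xl M -> Xr M ->
  (forall B, Xl B -> exists2 A, Xl A & first_syzygy T A B) ->
  (forall A, Xr A -> exists2 B, Xr B & first_syzygy T A B) ->
  exists2 Z : int -> lmodType R, Z 0 = M & forall i, first_syzygy T (Z (i + 1)) (Z i).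
Proof.
move=> XlM XrM left right.
have [|Zl Zl0 ZlP] := @dependent_choice _ (fun _ => Xl)
  (fun _ B A => first_syzygy T A B) M XlM; first by move=> _ B /left.
have [|Zr Zr0 ZrP] := @dependent_choice _ (fun _ => Xr)
  (fun _ A B => first_syzygy T A B) M XrM; first by move=> _ A /right.
exists (fun i : int => match i with Posz n => Zl n | Negz n => Zr n.+1 end) => //.
case=> n; first by rewrite -PoszD addn1; case: (ZlP n).
case: n => [|n]; first by have := (ZrP 0%N).2; rewrite Zr0 -Zl0.
have -> : Negz n.+1 + 1 = Negz n by rewrite !NegzE [n.+2%:Z]intS opprD addrAC addNr add0r.
by case: (ZrP n.+1).
Qed.

Lemma splice_complex (T : mono_kind) (Z : int -> lmodType R) :
  (forall i, first_syzygy T (Z (i + 1)) (Z i)) ->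
  exists C, exists2 f : forall i, {linear Z (i + 1) -> C i},
    forall i, [/\ projective_module (C i), injective (f i) & T _ _ (f i)] &
    exists2 g : forall i, {linear C i -> Z i},
      forall i, is_surjective (g i) /\ exact_pair (f i) (g i) &
      forall i x, diff C i x = f i (g (i + 1) x).
Proof.
move=> ZP.
have [c cP] : exists c : forall i,
    {P : lmodType R & ({linear Z (i + 1)%R -> P} * {linear P -> Z i})%type},
    forall i, let f := (projT2 (c i)).1 in let g := (projT2 (c i)).2 in
    [/\ projective_module (projT1 (c i)), injective f, exact_pair f g,
      is_surjective g & T _ _ f].
  have cex i : exists c : {P : lmodType R &
      ({linear Z (i + 1)%R -> P} * {linear P -> Z i})%type},
      let f := (projT2 c).1 in let g := (projT2 c).2 in
      [/\ projective_module (projT1 c), injective f, exact_pair f g,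
        is_surjective g & T _ _ f].
    by have [P [f [g fgP]]] := ZP i; exists (existT _ P (f, g)).
  by exists (fun i => projT1 (cid (cex i))) => i; exact: projT2 (cid (cex i)).
pose C := @ZSeq R (fun i => projT1 (c i))
  (fun i => (projT2 (c i)).1 \o (projT2 (c (i + 1))).2).
exists C, (fun i => (projT2 (c i)).1); first by move=> i; case: (cP i).
by exists (fun i => (projT2 (c i)).2) => // i; case: (cP i).
Qed.

Section Splice.
Context (T : mono_kind) (Z : int -> lmodType R) (C : zseq R).
Context (f : forall i, {linear Z (i + 1) -> C i}) (g : forall i, {linear C i -> Z i}).
Hypothesis fP : forall i, [/\ projective_module (C i), injective (f i) & T (f i)].
Hypothesis gP : forall i, is_surjective (@g i) /\ exact_pair (f i) (@g i).
Hypothesis diffE : forall i x, diff C i x = f i (g (i + 1) x).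

Lemma splice_diff0 i x : diff C i x = 0 <-> g (i + 1) x = 0.
Proof.
have [_ fI _] := fP i; rewrite diffE; split=> [h|->]; last by rewrite linear0.
by apply: fI; rewrite h linear0.
Qed.

Lemma splice_exact : exact_complex C.
Proof.
move=> i y; rewrite splice_diff0; have [_ fg] := gP (i + 1).
rewrite fg; split=> [[z <-]|[x <-]]; last by rewrite diffE; exists (g (i + 1 + 1) x).
by have [x <-] := (gP (i + 1 + 1)).1 z; exists x; rewrite diffE.
Qed.

Lemma splice_syzygy i j : j = i + 1 + 1 -> syzygy C (Z j).
Proof.
move=> ->; exists i, (f (i + 1)); have [_ fI _] := fP (i + 1); split=> // y.
by rewrite splice_diff0; apply: (gP (i + 1)).2.
Qed.

Lemma splice_tensor_exact :
  (forall i, tensor_mono (f i)) ->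
  forall E : lmodType R^c, injective_module E -> tensor_exact E C.
Proof.
move=> ft E Einj i t; split=> [|[s <-]]; last first.
  rewrite -(tensor_map_comp (h := (diff C i \o diff C (i + 1)))) ?tensor_map0// => x.
  exact: exact_complex_diff splice_exact i x.
rewrite (tensor_map_comp (diffE (i := i))) => fgt0.
have gt0 : tensor_map E (g (i + 1)) t = 0.
  by apply: (ft i E Einj); rewrite fgt0 raddf0.
have [gS fg] := gP (i + 1).
have [s <-] := tensor_right_exact fg gS gt0.
have [r <-] := tensor_map_surjective (gP (i + 1 + 1)).1 s.
by exists r; rewrite (tensor_map_comp (diffE (i := i + 1))).
Qed.

Lemma splice_hom_exact :
  (forall i, extending (f i)) -> forall Q, projective_module Q -> hom_exact C Q.
Proof.
move=> fe Q Qp i phi; split=> [phi0|[psi psiE] x]; last first.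
  by rewrite -psiE (exact_complex_diff splice_exact) linear0.
have [|h hE] := @factor_through_epi _ _ _ _ (g (i + 1)) phi (gP (i + 1)).1.
  by move=> x /splice_diff0/splice_exact[y <-].
have [psi psiE] := fe i Q Qp h.
by exists psi => x; rewrite diffE psiE hE.
Qed.

End Splice.
End Syzygies.

(** * PGF and Gorenstein projective modules by coinduction *)

Section PGF.
Context (R : pzRingType).
Implicit Types (A B K M N P Q G W : lmodType R) (C : zseq R) (i : int).

Lemma first_syzygy_sub (S T : mono_kind R) A B :
  (forall K P (f : {linear K -> P}), S K P f -> T K P f) ->
  first_syzygy S A B -> first_syzygy T A B.
Proof.
by move=> ST [P [f [g [Pp fI fg gS Sf]]]]; exists P, f, g; split=> //; apply: ST.
Qed.

(** Inclusions that are exact both under tensoring with injectives and under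
    Hom(-, projective); those of PGF modules in their complexes are of this
    kind. *)
Definition perfect_mono : mono_kind R :=
  fun A P f => tensor_mono f /\ extending f.

Lemma PGF_complex_perfect C :
  complex_of_projectives C -> exact_complex C ->
  (forall E : lmodType R^c, injective_module E -> tensor_exact E C) ->
  forall i K (k : {linear K -> C (i + 1)}),
    injective k -> exact_pair k (diff C i) -> perfect_mono k.
Proof.
move=> Cp Ce Ct i K k kI ke; split; first exact: syzygy_tensor_mono ke.
apply: syzygy_extending ke => // Q Qp.
exact: tensor_exact_hom_exact Cp Qp (exact_complex_diff Ce) Ct.
Qed.

Lemma PGF_left M : PGF M -> exists2 A, PGF A & first_syzygy perfect_mono A M.
Proof.
move=> [C [Cp Ce Ct CM]].
have [A CA AM] := syzygy_left Ce Cp (PGF_complex_perfect Cp Ce Ct) CM.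
by exists A => //; exists C.
Qed.

Lemma PGF_right M : PGF M -> exists2 B, PGF B & first_syzygy perfect_mono M B.
Proof.
move=> [C [Cp Ce Ct CM]].
have [B CB MB] := syzygy_right Ce Cp (PGF_complex_perfect Cp Ce Ct) CM.
by exists B => //; exists C.
Qed.

Lemma gorenstein_left M : gorenstein_projective M ->
  exists2 A, gorenstein_projective A & first_syzygy (@extending R) A M.
Proof.
move=> [C [Cp Ce Ch CM]].
have [A CA AM] := syzygy_left Ce Cp (syzygy_extending Ce Ch) CM.
by exists A => //; exists C.
Qed.

Lemma gorenstein_right M : gorenstein_projective M ->
  exists2 B, gorenstein_projective B & first_syzygy (@extending R) M B.
Proof.
move=> [C [Cp Ce Ch CM]].
have [B CB MB] := syzygy_right Ce Cp (syzygy_extending Ce Ch) CM.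
by exists B => //; exists C.
Qed.

(** The class of PGF modules is the greatest one from which tensor-exact short
    exact sequences with projective middle term can be continued in both
    directions. *)
Lemma PGF_coinduction (Xl Xr : lmodType R -> Prop) M :
  Xl M -> Xr M ->
  (forall B, Xl B -> exists2 A, Xl A & first_syzygy (@tensor_mono R) A B) ->
  (forall A, Xr A -> exists2 B, Xr B & first_syzygy (@tensor_mono R) A B) ->
  PGF M.
Proof.
move=> XlM XrM left right.
have [Z <- ZP] := bi_infinite_splice XlM XrM left right.
have [C [f fP [g gP dE]]] := splice_complex ZP.
exists C; split.
- by move=> i; case: (fP i).
- exact: splice_exact fP gP dE.
- by apply: (splice_tensor_exact fP gP dE) => i; case: (fP i).
- exact: (splice_syzygy fP gP dE (i := -2%:Z)).
Qed.

Lemma gorenstein_coinduction (Xl Xr : lmodType R -> Prop) M :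
  Xl M -> Xr M ->
  (forall B, Xl B -> exists2 A, Xl A & first_syzygy (@extending R) A B) ->
  (forall A, Xr A -> exists2 B, Xr B & first_syzygy (@extending R) A B) ->
  gorenstein_projective M.
Proof.
move=> XlM XrM left right.
have [Z <- ZP] := bi_infinite_splice XlM XrM left right.
have [C [f fP [g gP dE]]] := splice_complex ZP.
exists C; split.
- by move=> i; case: (fP i).
- exact: splice_exact fP gP dE.
- by apply: (splice_hom_exact fP gP dE) => i; case: (fP i).
- exact: (splice_syzygy fP gP dE (i := -2%:Z)).
Qed.

Lemma PGF_left_tensor M : PGF M ->
  exists2 A, PGF A & first_syzygy (@tensor_mono R) A M.
Proof.
by move=> /PGF_left[A PA AM]; exists A => //; apply: first_syzygy_sub AM => K P f [].
Qed.

Lemma PGF_right_tensor M : PGF M ->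
  exists2 B, PGF B & first_syzygy (@tensor_mono R) M B.
Proof.
by move=> /PGF_right[B PB MB]; exists B => //; apply: first_syzygy_sub MB => K P f [].
Qed.

Lemma PGF_between A M B :
  PGF A -> first_syzygy (@tensor_mono R) A M ->
  PGF B -> first_syzygy (@tensor_mono R) M B -> PGF M.
Proof.
move=> PA AM PB MB.
apply: (@PGF_coinduction (fun X => exists2 A, PGF A & first_syzygy (@tensor_mono R) A X)
  (fun X => exists2 B, PGF B & first_syzygy (@tensor_mono R) X B)).
- by exists A.
- by exists B.
- move=> X [Y PY YX]; exists Y => //; exact: PGF_left_tensor.
- move=> X [Y PY XY]; exists Y => //; exact: PGF_right_tensor.
Qed.

Lemma gorenstein_between A M B :
  gorenstein_projective A -> first_syzygy (@extending R) A M ->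
  gorenstein_projective B -> first_syzygy (@extending R) M B ->
  gorenstein_projective M.
Proof.
move=> PA AM PB MB.
apply: (@gorenstein_coinduction
  (fun X => exists2 A, gorenstein_projective A & first_syzygy (@extending R) A X)
  (fun X => exists2 B, gorenstein_projective B & first_syzygy (@extending R) X B)).
- by exists A.
- by exists B.
- move=> X [Y PY YX]; exists Y => //; exact: gorenstein_left.
- move=> X [Y PY XY]; exists Y => //; exact: gorenstein_right.
Qed.

(** * Direct sums with projective modules *)

Definition sum_stable (T : mono_kind R) :=
  (forall A P Q (f : {linear A -> P}) (f' : {linear A -> (P * Q)%type}),
     (forall x, f' x = (f x, 0)) -> T A P f -> T _ _ f') /\
  (forall A P Q (f : {linear A -> P}) (f' : {linear (A * Q)%type -> (P * Q)%type}),
     (forall x, f' x = (f x.1, x.2)) -> T A P f -> T _ _ f').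

(** The tensor product with a direct sum splits, by the projections and
    injections. *)
Lemma tensor_mono_sum_stable : sum_stable (@tensor_mono R).
Proof.
split=> A P Q f f' fE ft E Einj.
  move=> t t' /(congr1 (tensor_map E (fst : {linear (P * Q)%type -> P}))).
  rewrite -!(tensor_map_comp (h := f)); try by move=> x; rewrite fE.
  exact: ft.
have fst_f t : tensor_map E f (tensor_map E (fst : {linear (A * Q)%type -> A}) t) =
    tensor_map E (fst : {linear (P * Q)%type -> P}) (tensor_map E f' t).
  rewrite -!(tensor_map_comp (h := f \o fst)) //.
  by move=> x; rewrite fE.
apply: tensor_injective => t ft0.
have t1 : tensor_map E (fst : {linear (A * Q)%type -> A}) t = 0.
  by apply: (ft E Einj); rewrite fst_f ft0 !raddf0.
have t2 : tensor_map E (snd : {linear (A * Q)%type -> Q}) t = 0.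
  rewrite (tensor_map_comp (f := f') (g := snd)) ?ft0 ?raddf0// => x.
  by rewrite fE.
have [i iE] := pair_exists (idfun : {linear A -> A}) (\0 : {linear A -> Q}).
have [j jE] := pair_exists (\0 : {linear Q -> A}) (idfun : {linear Q -> Q}).
rewrite -[t](tensor_map_id (f := idfun))//.
rewrite (tensor_mapD (f := i \o fst) (g := j \o snd)); last first.
  by move=> [x y] /=; rewrite iE jE -[RHS]/(x + 0, 0 + y) addr0 add0r.
rewrite (tensor_map_comp (f := fst) (g := i))// t1 raddf0 add0r.
by rewrite (tensor_map_comp (f := snd) (g := j))// t2 raddf0.
Qed.

Lemma extending_sum_stable : sum_stable (@extending R).
Proof.
split=> A P Q f f' fE fe X Xp phi.
  have [psi psiE] := fe X Xp phi.
  by exists (psi \o fst) => x; rewrite fE/= psiE.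
have [i iE] := pair_exists (idfun : {linear A -> A}) (\0 : {linear A -> Q}).
have [j jE] := pair_exists (\0 : {linear Q -> A}) (idfun : {linear Q -> Q}).
have [psi psiE] := fe X Xp (phi \o i).
have [h hE] := copair_exists psi (phi \o j).
exists h => -[x y]; rewrite hE fE/= psiE/= -linearD iE jE.
by congr (phi _); rewrite -[LHS]/(x + 0, 0 + y) addr0 add0r.
Qed.

Lemma first_syzygy_sum_left (T : mono_kind R) A M Q : sum_stable T ->
  projective_module Q -> first_syzygy T A M -> first_syzygy T A (M * Q)%type.
Proof.
move=> [sumT _] Qp [P [f [g [Pp fI fg gS Tf]]]].
have [f' fE] := pair_exists f (\0 : {linear A -> Q}).
have [g' gE] := pair_exists (g \o fst) (snd : {linear (P * Q)%type -> Q}).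
exists (P * Q)%type, f', g'; split.
- exact: projective_sum.
- by move=> x y; rewrite !fE => -[/fI].
- move=> [x y]; rewrite gE/=; split=> [[/fg[a <-] ->]|[a]].
    by exists a; rewrite fE.
  by rewrite fE => -[<- <-] /=; congr (_, _); apply/fg; exists a.
- by move=> [m q]; have [x <-] := gS m; exists (x, q); rewrite gE.
- exact: sumT fE Tf.
Qed.

Lemma first_syzygy_sum_right (T : mono_kind R) M B Q : sum_stable T ->
  projective_module Q -> first_syzygy T M B -> first_syzygy T (M * Q)%type B.
Proof.
move=> [_ sumT] Qp [P [f [g [Pp fI fg gS Tf]]]].
have [f' fE] := pair_exists (f \o fst) (snd : {linear (M * Q)%type -> Q}).
exists (P * Q)%type, f', (g \o fst); split.
- exact: projective_sum.
- by move=> [x1 x2] [y1 y2]; rewrite !fE => -[/fI -> ->].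
- move=> [x y] /=; split=> [/fg[a <-]|[a]].
    by exists (a, y); rewrite fE.
  by rewrite fE => -[<- _] /=; apply/fg; exists a.1.
- by move=> b; have [x <-] := gS b; exists (x, 0).
- exact: sumT fE Tf.
Qed.

Lemma PGF_sum M Q : PGF M -> projective_module Q -> PGF (M * Q)%type.
Proof.
move=> PM Qp; have [A PA AM] := PGF_left_tensor PM.
have [B PB MB] := PGF_right_tensor PM.
apply: (PGF_between PA _ PB).
  exact: first_syzygy_sum_left tensor_mono_sum_stable Qp AM.
exact: first_syzygy_sum_right tensor_mono_sum_stable Qp MB.
Qed.

Lemma gorenstein_sum M Q :
  gorenstein_projective M -> projective_module Q -> gorenstein_projective (M * Q)%type.
Proof.
move=> PM Qp; have [A PA AM] := gorenstein_left PM.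
have [B PB MB] := gorenstein_right PM.
apply: (gorenstein_between PA _ PB).
  exact: first_syzygy_sum_left extending_sum_stable Qp AM.
exact: first_syzygy_sum_right extending_sum_stable Qp MB.
Qed.

(** * Pullbacks along projective covers *)

(** From a morphism of short exact sequences (A0 -> P -> A1) to (B0 -> Q -> B1)
    and a cover P' of B0, one gets W0 -> P + P' -> W1, where W0 is the pullback of
    A0 -> B0 <- P' and W1 that of A1 -> B1 <- Q.  These are consecutive syzygies of
    the mapping cone of a morphism of complexes, but the cone need not be
    formed. *)
Section PullbackStep.
Context (A0 P A1 B0 Q B1 B' P' W0 W1 : lmodType R).
Context (i : {linear A0 -> P}) (p : {linear P -> A1}).
Context (j : {linear B0 -> Q}) (q : {linear Q -> B1}).
Context (F : {linear P -> Q}) (f0 : {linear A0 -> B0}) (f1 : {linear A1 -> B1}).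
Context (k : {linear B' -> P'}) (c : {linear P' -> B0}).
Context (u0 : {linear W0 -> (A0 * P')%type}) (u1 : {linear W1 -> (A1 * Q)%type}).
Hypotheses (Pproj : projective_module P) (P'proj : projective_module P').
Hypotheses (iI : injective i) (ip : exact_pair i p) (pS : is_surjective p).
Hypotheses (jI : injective j) (jq : exact_pair j q).
Hypotheses (kc : exact_pair k c) (cS : is_surjective c).
Hypotheses (it : tensor_mono i) (kt : tensor_mono k).
Hypotheses (Fi : forall x, F (i x) = j (f0 x)) (fp : forall x, f1 (p x) = q (F x)).
Hypotheses (pb0 : is_pullback f0 c u0) (pb1 : is_pullback f1 q u1).

Let pi_A0 : {linear W0 -> A0} := fst \o u0.
Let pi_P' : {linear W0 -> P'} := snd \o u0.

Lemma pullback_proj_surjective : is_surjective pi_A0.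
Proof.
move=> a; have [y cy] := cS (f0 a).
by have /(pb0.2 a y)[w wE] := esym cy; exists w; rewrite /pi_A0/= wE.
Qed.

Lemma pullback_commutes w : f0 (pi_A0 w) = c (pi_P' w).
Proof. by apply/pb0.2; exists w; rewrite /pi_A0 /pi_P'/=; case: (u0 w). Qed.

(** The second map is (x, y) |-> (p x, F x - j (c y)).  For the tensor condition:
    W0 is an extension of A0 by B', so an element of E (x) W0 dying in E (x) P
    comes from E (x) B', and dies in E (x) P' only if it is zero. *)
Lemma pullback_first_syzygy : first_syzygy (@tensor_mono R) W0 W1.
Proof.
have qj x : q (j x) = 0 by apply/jq; exists x.
have pi0 x : p (i x) = 0 by apply/ip; exists x.
have [f fE] := pair_exists (i \o pi_A0) pi_P'.
have [h1 h1E] := copair_exists (p : {linear P -> A1}) (\0 : {linear P' -> A1}).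
have [h2 h2E] := copair_exists F (\- (j \o c)).
have [h hE] := pair_exists h1 h2.
have [|g gE] := @lift_along_mono R _ _ _ u1 h pb1.1.
  move=> [x y]; rewrite hE h1E h2E/= addr0; apply/pb1.2.
  by rewrite linearB qj subr0 fp.
have {h1E h2E}gE x y : u1 (g (x, y)) = (p x, F x - j (c y)).
  by rewrite gE hE h1E h2E/= addr0.
exists (P * P')%type, f, g; split.
- exact: projective_sum.
- apply: linear_injective => w; rewrite fE => -[iw cw]; apply: pb0.1.
  rewrite linear0 [u0 w]surjective_pairing cw.
  by congr (_, _); apply: iI; rewrite linear0.
- move=> [x y]; split=> [gxy0|[w]]; last first.
    rewrite fE => -[<- <-]; apply: pb1.1; rewrite gE linear0 /=.
    by rewrite pi0 Fi -pullback_commutes subrr.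
  have := gE x y; rewrite gxy0 linear0 => -[/esym/ip[a ax] /esym/eqP].
  rewrite subr_eq0 -ax Fi => /eqP/jI/pb0.2[w wE].
  by exists w; rewrite fE /pi_A0 /pi_P'/= wE.
- move=> w; have [x px] := pS (u1 w).1.
  have /jq[b bE] : q ((u1 w).2 - F x) = 0.
    rewrite linearB -fp px; apply/eqP; rewrite subr_eq0; apply/eqP/esym/pb1.2.
    by exists w; case: (u1 w).
  have [y yb] := cS b; exists (x, - y); apply: pb1.1.
  by rewrite gE px !linearN opprK yb bE [F x + _]addrC subrK -surjective_pairing.
- move=> E Einj; apply: tensor_injective => t ft0.
  have [l lE] := pair_exists (\0 : {linear B' -> A0}) k.
  have [|m mE] := @lift_along_mono R _ _ _ u0 l pb0.1.
    move=> z; rewrite lE; apply/pb0.2; rewrite linear0; apply/esym/kc.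
    by exists z.
  have m_exact : exact_pair m pi_A0.
    move=> w; split=> [w0|[z <-]]; last by rewrite /pi_A0/= mE lE.
    have /esym/kc[z zw] : 0 = c (pi_P' w) by rewrite -pullback_commutes w0 linear0.
    exists z; apply: pb0.1; rewrite mE lE zw [RHS]surjective_pairing.
    by rewrite -[(u0 w).1]/(pi_A0 w) w0.
  have [s st] : exists s, tensor_map E m s = t.
    apply: (tensor_right_exact m_exact pullback_proj_surjective).
    apply: (it Einj); rewrite raddf0 -(tensor_map_comp (h := fst \o f)); last first.
      by move=> x /=; rewrite fE.
    by rewrite (tensor_map_comp (f := f) (g := fst))// ft0 raddf0.
  rewrite -st (_ : s = 0) ?raddf0//; apply: (kt Einj); rewrite raddf0.
  rewrite (tensor_map_comp (f := m) (g := pi_P')); last first.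
    by move=> z; rewrite /pi_P'/= mE lE.
  by rewrite st (tensor_map_comp (f := f) (g := snd)) ?ft0 ?raddf0// => x; rewrite fE.
Qed.

End PullbackStep.

(** The class to which coinduction applies: pullbacks of a map of PGF modules
    along a projective cover of its target with PGF kernel. *)
Definition PGF_cover_pullback W :=
  exists A B B' P' (f : {linear A -> B}) (k : {linear B' -> P'})
    (c : {linear P' -> B}) (u : {linear W -> (A * P')%type}),
  [/\ PGF A, PGF B & PGF B'] /\
  [/\ projective_module P', injective k, exact_pair k c, is_surjective c & tensor_mono k] /\
  is_pullback f c u.

(** To the right, f extends to the coresolutions because that of A is
    Hom(-, projective)-exact, and the old coresolution of B provides the new
    cover.  To the left, f lifts to the projective resolutions. *)
Lemma PGF_pullback W : PGF_cover_pullback W -> PGF W.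
Proof.
move=> WP; apply: (@PGF_coinduction PGF_cover_pullback PGF_cover_pullback) => // {W WP}W.
  move=> [A [B [B' [P' [f [k [c [u [[PA PB PB'] [[P'p kI kc cS kt] pb]]]]]]]]]].
  have [A1 PA1 [P [i [p [Pp iI ip pS [it _]]]]]] := PGF_left PA.
  have [B2 PB2 [P2 [k2 [c2 [P2p k2I kc2 c2S [k2t _]]]]]] := PGF_left PB'.
  have [F FE] := Pp _ _ c (f \o p) cS.
  have [|f1 f1E] := @lift_along_mono R _ _ _ k (F \o i) kI.
    move=> x; apply/kc; rewrite /= FE/= (_ : p (i x) = 0) ?linear0//.
    by apply/ip; exists x.
  have [W' [u' pb']] := pullback_exists f1 c2.
  exists W'; last by apply: (pullback_first_syzygy (F := F) (f0 := f1) (f1 := f)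
    (i := i) (p := p) (j := k) (q := c) (k := k2) (c := c2) (u0 := u') (u1 := u)).
  by exists A1, B', B2, P2, f1, k2, c2, u'.
move=> [A [B [B' [P' [f [k [c [u [[PA PB PB'] [[P'p kI kc cS kt] pb]]]]]]]]]].
have [A1 PA1 [P [i [p [Pp iI ip pS [it ie]]]]]] := PGF_right PA.
have [B1 PB1 [Q [j [q [Qp jI jq qS [jt _]]]]]] := PGF_right PB.
have [F FE] := ie Q Qp (j \o f).
have [|f1 f1E] := @factor_through_epi R _ _ _ p (q \o F) pS.
  move=> x /ip[a <-] /=; rewrite FE/=; apply/jq.
  by exists (f a).
have [W' [u' pb']] := pullback_exists f1 q.
exists W'; last by apply: (pullback_first_syzygy (F := F) (f0 := f) (f1 := f1)
    (i := i) (p := p) (j := j) (q := q) (k := k) (c := c) (u0 := u) (u1 := u')).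
by exists A1, B1, B, Q, f1, j, q, u'.
Qed.

(** * Retracts of PGF modules *)

Definition retract_of_PGF M := exists G (i : {linear M -> G}) (r : {linear G -> M}),
  PGF G /\ forall x, r (i x) = x.

(** Let G retract onto N and G -> Q -> G' come from the complex of G.  The
    inclusion and the retraction extend to maps h : P -> Q and k : Q -> P, by exactness under
    Hom(-, projective) on both sides.  Since h restricts to G -> Q on N, the
    inclusion of N in P is tensor-exact.  The map 1 - k h kills N, so it factors
    through M, and together with the map M -> G' induced by h it exhibits M as a
    retract of G' + P. *)
Lemma retract_of_PGF_step N M :
  retract_of_PGF N -> first_syzygy (@extending R) N M ->
  first_syzygy (@tensor_mono R) N M /\ retract_of_PGF M.
Proof.
move=> [G [i [r [PG ri]]]] [P [a [pi [Pp aI api piS ae]]]].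
have [G' PG' [Q [j [rho [Qp jI jrho rhoS [jt je]]]]]] := PGF_right PG.
have [h hE] := ae Q Qp (j \o i).
have [k kE] := je P Pp (a \o r).
have pia x : pi (a x) = 0 by apply/api; exists x.
have rhoj x : rho (j x) = 0 by apply/jrho; exists x.
split.
  exists P, a, pi; split=> // E Einj t t' /(congr1 (tensor_map E h)).
  rewrite -!(tensor_map_comp (h := j \o i)); try by move=> x; rewrite hE.
  rewrite !(tensor_map_comp (f := i) (g := j) (h := j \o i))// => /(jt E Einj).
  move=> /(congr1 (tensor_map E r)).
  rewrite -!(tensor_map_comp (h := idfun)); try by move=> x; rewrite ri.
  by rewrite !tensor_map_id.
have [|hb hbE] := @factor_through_epi R _ _ _ pi (rho \o h) piS.
  by move=> x /api[y <-] /=; rewrite hE/= rhoj.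
have [|kb kbE] := @factor_through_epi R _ _ _ rho (pi \o k) rhoS.
  by move=> x /jrho[y <-] /=; rewrite kE/= pia.
have [|th thE] := @factor_through_epi R _ _ _ pi (idfun \- (k \o h)) piS.
  by move=> x /api[y <-] /=; rewrite hE/= kE/= ri subrr.
have [s sE] := pair_exists hb th.
have [t tE] := copair_exists kb pi.
exists (G' * P)%type, s, t; split; first exact: PGF_sum.
move=> y; have [x <-] := piS y.
by rewrite tE sE/= hbE/= kbE/= thE/= linearB addrC subrK.
Qed.

(** Left continuations come from N being PGF; to the right,
    [retract_of_PGF_step] propagates along the coresolution of M as a Gorenstein
    projective module. *)
Lemma gorenstein_PGF_step N M :
  gorenstein_projective M -> PGF N -> first_syzygy (@extending R) N M -> PGF M.
Proof.
move=> GM PN NM.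
have rN : retract_of_PGF N by exists N, idfun, idfun.
have [NMt rM] := retract_of_PGF_step rN NM.
apply: (@PGF_coinduction (fun X => exists2 A, PGF A & first_syzygy (@tensor_mono R) A X)
  (fun X => gorenstein_projective X /\ retract_of_PGF X)) => //.
- by exists N.
- move=> X [Y PY YX]; exists Y => //; exact: PGF_left_tensor.
- move=> X [GX rX]; have [B GB XB] := gorenstein_right GX.
  by have [XBt rB] := retract_of_PGF_step rX XB; exists B.
Qed.

(** * Induction on the length of a PGF resolution *)

Lemma PGF_iso G M (f : {linear G -> M}) :
  injective f -> is_surjective f -> PGF G -> PGF M.
Proof.
move=> fI fS [C [Cp Ce Ct [i [k [kI ke]]]]].
have [|h hE] := @lift_along_mono R _ _ _ f (idfun : {linear M -> M}) fI.
  by move=> y; have [x <-] := fS y; exists x.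
exists C; split=> //; exists i, (k \o h); split.
  by move=> x y /kI /(congr1 f); rewrite !hE.
move=> y; rewrite ke; split=> [[x <-]|[x <-]]; last by exists (h x).
by exists (f x); congr (k _); apply: fI; rewrite hE.
Qed.

(** The induction step replaces M by its syzygy N = A + C0, which has a resolution
    shorter by one starting with the pullback W. *)
Lemma gorenstein_PGF_resolution n M :
  gorenstein_projective M -> PGF_resolution M n -> PGF M.
Proof.
elim: n M => [|n IHn] M GM [G [d [eps [PG G0 epsS eps_exact d_exact]]]].
  apply: (PGF_iso (f := eps)) => //; last exact: PG.
  apply: linear_injective => x /eps_exact[y <-].
  by rewrite (G0 1%N _ y)// linear0.
have [A GA [P [a [pi [Pp aI api piS ae]]]]] := gorenstein_left GM.
have [B' PB' [C0 [k [c [C0p kI kc cS kt]]]]] := PGF_left_tensor (PG 0%N isT).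
have [l lE] := Pp _ _ eps pi epsS.
have [s sE] := C0p _ _ pi (eps \o c) piS.
have [f fE] := copair_exists (d 0%N) l.
have [W [u pb]] := pullback_exists f c.
have PW : PGF W.
  apply: PGF_pullback; exists (G 1%N * P)%type, (G 0%N), B', C0, f, k, c, u.
  by split; [split=> //; [apply: PGF_sum => //|]; apply: PG|].
pose N : lmodType R := (A * C0)%type.
have GN : gorenstein_projective N by apply: gorenstein_sum.
have NM : first_syzygy (@extending R) N M.
  apply: first_syzygy_sum_right extending_sum_stable C0p _.
  by exists P, a, pi.
apply: gorenstein_PGF_step GM (IHn N GN _) NM.
have epsd x : eps (d 0%N x) = 0 by apply/eps_exact; exists x.
have uE w : d 0%N (u w).1.1 + l (u w).1.2 = c (u w).2.
  by rewrite -fE; apply/pb.2; exists w; case: (u w).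
(* W -> A sends ((g, p), c) to p - s c, where s lifts C0 -> G 0 -> M to P. *)
have [|e1 e1E] := @lift_along_mono R _ _ _ a
    ((snd \o (fst \o u)) \- (s \o (snd \o u))) aI.
  move=> w; apply/api; rewrite /= linearB sE/= -uE linearD epsd lE.
  by rewrite add0r subrr.
have [e eE] := pair_exists e1 (snd \o u).
have [v1 v1E] := pair_exists (d 1%N) (\0 : {linear G 2%N -> P}).
have [v vE] := pair_exists v1 (\0 : {linear G 2%N -> C0}).
have [|d0 d0E] := @lift_along_mono R _ _ _ u v pb.1.
  move=> x; rewrite vE v1E; apply/pb.2; rewrite fE !linear0 addr0.
  by apply/d_exact; exists x.
have d0E' x : u (d0 x) = (d 1%N x, 0, 0) by rewrite d0E vE v1E.
pose G' m := if m is m'.+1 then G m'.+2 else W.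
pose d' m : {linear G' m.+1 -> G' m} :=
  match m with 0%N => d0 | m'.+1 => d m'.+2 end.
exists G', d', e; split.
- by case=> [|m] // mn; apply: PG.
- by case=> [|m] // mn x; apply: G0 x.
- move=> [x y].
  have /eps_exact[g gE] : eps (c y - l (a x + s y)) = 0.
    rewrite linearB lE linearD sE/= (_ : pi (a x) = 0) ?add0r ?subrr//.
    by apply/api; exists x.
  have /pb.2[w wE] : f (g, a x + s y) = c y by rewrite fE/= gE subrK.
  exists w; rewrite eE/= wE; congr (_, _); apply: aI.
  by rewrite e1E/= wE/= addrK.
- move=> w; rewrite eE/=; split=> [[e10 w2]|[x <-]]; last first.
    congr (_, _); last by rewrite /= d0E'.
    by apply: aI; rewrite e1E/= d0E'/= !linear0 ?subr0 ?addr0.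
  have := e1E w; rewrite e10 linear0/= w2 linear0 subr0 => w12.
  have /d_exact[x xE] : d 0%N (u w).1.1 = 0.
    by have := uE w; rewrite w2 -w12 !linear0 addr0.
  exists x; apply: pb.1; rewrite d0E' xE.
  by move: w2 w12; case: (u w) => -[? ?] ? /= -> <-.
- case=> [|m] x; last exact: d_exact.
  rewrite /= -d_exact.
  split=> [h|h]; last by apply: pb.1; rewrite d0E' h linear0.
  by have := congr1 u h; rewrite d0E' linear0 => -[].
Qed.

Lemma PGF_resolution0 M : PGF M -> PGF_resolution M 0.
Proof.
move=> PM; pose Z : lmodType R := 'rV[R]_0.
pose G n := if n is _.+1 then Z else M.
pose d n : {linear G n.+1 -> G n} :=
  match n with 0%N => \0 | _.+1 => \0 end.
have Z0 (x : Z) : x = 0 by apply/rowP => -[].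
exists G, d, idfun; split=> //.
- by case.
- by case=> // n _ x; apply: Z0.
- by move=> y; exists y.
- by move=> y; split=> [/= ->|[x <-]//]; exists 0.
- move=> n y; split=> _; last by case: n y.
  by exists 0; rewrite [LHS](Z0 _) [RHS](Z0 _).
Qed.

End PGF.

(** * The PGF dimension *)

Local Open Scope nat_scope.

Theorem proposition4p6 (R : pzRingType) :
  (forall M : lmodType R, gorenstein_projective M ->
     PGF_pd M = Some 0%N \/ PGF_pd M = infinity) /\
  (PGFD (@gorenstein_projective R) = Some 0%N \/
   PGFD (@gorenstein_projective R) = infinity).
Proof.
have pd0 (M : lmodType R) : gorenstein_projective M ->
    PGF_pd M = Some 0 \/ PGF_pd M = infinity.
  move=> GM; case pdM: (PGF_pd M) => [n|]; last by right.
  have [Mn nmin] := (least_some _ _).1 pdM; left; congr Some.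
  apply/eqP; rewrite -leqn0; apply: nmin; apply: PGF_resolution0.
  exact: gorenstein_PGF_resolution Mn.
split=> //.
have [[M [GM pdM]]|fin] := pselect (exists M : lmodType R,
    gorenstein_projective M /\ PGF_pd M = infinity).
  right; apply/least_infinity => n ub.
  by have := ub infinity (ex_intro _ M (conj GM pdM)).
left; apply/least_some; split=> // _ [M [GM <-]].
by have [->|pdM] := pd0 M GM; last by case: fin; exists M.
Qed.
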